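(* Let $G=\mathrm{SL}(2,\mathbf{R})$ act (locally) on $\mathbf{R}^2$ with coordinates $(x,u)$, where $x$ is the independent and $u$ the dependent variable, by $$(x,u)\longmapsto\Big(\frac{ax+b}{cx+d},\,u\Big),\qquad \begin{pmatrix}a&b\\c&d\end{pmatrix}\in \mathrm{SL}(2,\mathbf{R}),$$ whose infinitesimal generators are spanned by $\frac{\partial}{\partial x},\ x\frac{\partial}{\partial x},\ x^2\frac{\partial}{\partial x}$. Let $i_n, j_n, s_n, h_n$ be the numbers attached to the $n$-th prolonged action of $G$ on the jet space $J^{(n)}$ (defined in the context). Then: (1) the differential invariants of order at most $2$ are locally, near every point of $V^{(n)}$ with $n=0,1,2$ respectively, functions of $u$ alone, and the differential invariants of order at most $3$ are locally, near every point of $V^{(3)}$, functions of $u$ and $$\frac{2u_{(1)}u_{(3)}-3u_{(2)}^2}{2u_{(1)}^4};$$ (2) $i_0=i_1=i_2=1$ and $i_n=n-1$ for all $n\ge 3$; (3) $s_0=1$, $s_1=2$, and $s_n=3$ for all $n\ge 2$; (4) $j_0=1$, $j_1=j_2=0$, and $j_n=1$ for all $n\ge 3$; (5) $h_0=2$, $h_1=1$, and $h_n=0$ for all $n\ge 2$.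
   Context: The $n$-th jet space $J^{(n)}$ of $\mathbf{R}^2=\mathbf{R}\times\mathbf{R}$ (one independent variable $x$, one dependent variable $u$) is the Euclidean space $\mathbf{R}^{n+2}$ with coordinates $(x,u,u_{(1)},\dots,u_{(n)})$, where $u_{(k)}$ represents the $k$-th derivative of $u$ with respect to $x$ (and $u_{(0)}=u$). The group acts on $J^{(n)}$ by the (local) prolonged action, induced by its action on the $n$-jets of graphs of functions $u=f(x)$. If $v=\xi(x,u)\frac{\partial}{\partial x}+\varphi(x,u)\frac{\partial}{\partial u}$ is an infinitesimal generator of the action on $\mathbf{R}^2$, the corresponding infinitesimal generator of the prolonged action is $$v^{(n)}=\xi\frac{\partial}{\partial x}+\sum_{k=0}^n\varphi^k\frac{\partial}{\partial u_{(k)}},\qquad \varphi^k=D_x^k Q+\xi u_{(k+1)},\quad Q=\varphi-\xi u_{(1)},$$ where $D_x=\frac{\partial}{\partial x}+\sum_{k\ge0}u_{(k+1)}\frac{\partial}{\partial u_{(k)}}$ is the total derivative. The dimension of the orbit through a point of $J^{(n)}$ is the dimension of the span at that point of the prolonged generators $v^{(n)}$. A differential invariant of order at most $n$ is a smooth real-valued function $I$ on an open subset of $J^{(n)}$ that is annihilated by all prolonged infinitesimal generators: $v^{(n)}(I)=0$ for every generator $v$. Invariants $I_1,\dots,I_k$ are functionally independent if $dI_1\wedge\dots\wedge dI_k\ne0$. $s_n$ is the maximal dimension of the orbits of the prolonged action on $J^{(n)}$ (the generic orbit dimension), and $V^{(n)}\subset J^{(n)}$ is the set of points lying on orbits of dimension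 $s_n$. $i_n$ is the maximal number of functionally independent differential invariants of order at most $n$ in a neighbourhood of a point of $V^{(n)}$ (so $i_n=\dim J^{(n)}-s_n$). $j_n=i_n-i_{n-1}$ for $n\ge1$ is the number of strictly functionally independent differential invariants of order $n$, with $j_0=i_0$. $h_n=\dim G-s_n$ is the dimension of the isotropy group, for the prolonged action, of a point of $V^{(n)}$.
   Formalization: In (1), the claim for order at most 3 is stated only near points of V^(3) with u_(1) ≠ 0; V^(3) also contains points with u_(1) = 0, u_(2) ≠ 0, where the displayed function is undefined and the claim fails. *)

(* Defs.v *)
From mathcomp Require Import all_boot all_order all_algebra.
From mathcomp Require Import all_classical all_reals all_analysis.
Import Order.TTheory GRing.Theory Num.Theory numFieldNormedType.Exports.

Set Implicit Arguments.
Unset Strict Implicit.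
Unset Printing Implicit Defensive.

Local Open Scope classical_set_scope.
Local Open Scope ring_scope.

(* The value 0 is a junk value for an empty or unbounded set. *)
Definition nat_max (P : set nat) : nat :=
  xget 0%N [set k | P k /\ forall m, P m -> (m <= k)%N].

(* Dimension of the linear span of an arbitrary set of vectors: in finite
   dimension the span is attained by a finite family. *)
Definition span_dim (R : fieldType) (V : vectType R) (S : set V) : nat :=
  nat_max [set k | exists X : seq V,
    (forall x, x \in X -> S x) /\ k = (\dim <<X>>)%N].

Section Smooth.
Context {R : realType}.

Definition pderiv n (i : 'I_n) (f : 'rV[R]_n -> R) : 'rV[R]_n -> R :=
  fun p => 'D_(delta_mx 0 i) f p.

(* f is of class C^k on U; meaningful when U is open. *)
Fixpoint Ck_on n (k : nat) (U : set 'rV[R]_n) (f : 'rV[R]_n -> R) : Prop :=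
  match k with
  | 0 => forall p, U p -> {for p, continuous f}
  | k'.+1 => (forall p, U p -> differentiable f p) /\
             (forall i : 'I_n, Ck_on k' U (pderiv i f))
  end.

Definition smooth_on n (U : set 'rV[R]_n) (f : 'rV[R]_n -> R) : Prop :=
  forall k, Ck_on k U f.

(* The k-form dI_1 /\ ... /\ dI_k at p, evaluated on the vectors w_1 ... w_k. *)
Definition wedge_d n k (I : 'I_k -> 'rV[R]_n -> R) (p : 'rV[R]_n)
    (w : 'I_k -> 'rV[R]_n) : R :=
  \det (\matrix_(i < k, j < k) 'd (I i) p (w j)).

Definition functionally_independent n k (U : set 'rV[R]_n)
    (I : 'I_k -> 'rV[R]_n -> R) : Prop :=
  forall p, U p -> exists w, wedge_d I p w != 0.

End Smooth.

Section Jets.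
Context {R : realType}.

(* Coordinate 0 of a point of the n-th jet space is x; coordinate k.+1 is
   u_(k), for k <= n. The 0-th jet space is the plane with coordinates (x, u). *)
Definition jet (n : nat) := 'rV[R]_(n.+2).

Definition jcoord n (z : jet n) (i : nat) : R :=
  if insub i is Some i' then z 0 i' else 0.

Definition ju n (k : nat) (z : jet n) : R := jcoord z k.+1.

(* For m <= n this is the projection onto the m-th jet space; for m > n the
   new coordinates are set to 0. *)
Definition jresize n m (z : jet n) : jet m := \row_(i < m.+2) jcoord z i.

Definition vfield := jet 0 -> 'rV[R]_2.
Definition xi (v : vfield) (p : jet 0) : R := v p 0 0.
Definition phi (v : vfield) (p : jet 0) : R := v p 0 1.

(* Total derivative of a function of order m, as a function of order m + 1. *)
Definition total_deriv m (F : jet m -> R) : jet m.+1 -> R := fun z =>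
  pderiv ord0 F (jresize m z) +
  \sum_(k < m.+1) ju k.+1 z * pderiv (lift ord0 k) F (jresize m z).

Definition charQ (v : vfield) : jet 1 -> R := fun z =>
  phi v (jresize 0 z) - xi v (jresize 0 z) * ju 1 z.

Fixpoint iter_total_deriv (v : vfield) (k : nat) : jet k.+1 -> R :=
  match k with
  | 0 => charQ v
  | k'.+1 => total_deriv (@iter_total_deriv v k')
  end.

Definition phi_k (v : vfield) (k : nat) : jet k.+1 -> R := fun z =>
  @iter_total_deriv v k z + xi v (jresize 0 z) * ju k.+1 z.

(* phi_k is written with u_(k+1), but the terms in u_(k+1) cancel, so it does
   not matter that jresize sets u_(n+1) to 0 when k = n. *)
Definition prolong (v : vfield) n (z : jet n) : 'rV[R]_(n.+2) :=
  \row_(i < n.+2)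
    (if (i : nat) is k.+1 then @phi_k v k (jresize k.+1 z)
     else xi v (jresize 0 z)).

Section Invariants.
(* The set of infinitesimal generators of an action on the plane. *)
Variable gens : set vfield.

Definition orbit_dim n (z : jet n) : nat :=
  span_dim [set prolong v z | v in gens].

Definition s_ (n : nat) : nat := nat_max (range (@orbit_dim n)).

Definition V_ (n : nat) : set (jet n) := [set z | orbit_dim z = s_ n].

Definition diff_invariant n (U : set (jet n)) (I : jet n -> R) : Prop :=
  [/\ open U, smooth_on U I &
      forall v, gens v -> forall z, U z -> 'D_(prolong v z) I z = 0].

Definition i_ (n : nat) : nat :=
  nat_max [set k | exists (z : jet n) (U : set (jet n)) (I : 'I_k -> jet n -> R),
    [/\ @V_ n z, U z, (forall l, diff_invariant U (I l)) &
        functionally_independent U I]].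

Definition j_ (n : nat) : int :=
  if n is m.+1 then (i_ n)%:Z - (i_ m)%:Z else (i_ 0)%:Z.

Definition h_ (dimG : nat) (n : nat) : int := dimG%:Z - (s_ n)%:Z.

Definition invariant_near n (z : jet n) (I : jet n -> R) : Prop :=
  exists U : set (jet n), U z /\ diff_invariant U I.

End Invariants.

(* Near z, the function I is a smooth function of J_1, ..., J_k. *)
Definition function_of_near n k (z : jet n) (J : k.-tuple (jet n -> R))
    (I : jet n -> R) : Prop :=
  exists (W : set (jet n)) (O : set 'rV[R]_k) (f : 'rV[R]_k -> R),
    [/\ open W, W z, open O, smooth_on O f &
        forall w, W w -> let Jw := \row_(l < k) tnth J l w in
          O Jw /\ I w = f Jw].

End Jets.

Arguments jet : clear implicits.
Arguments vfield : clear implicits.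

Section SL2.
Context {R : realType}.

Definition SL2 : set 'M[R]_2 := [set g | \det g = 1].

(* Local action: meaningful where c x + d <> 0, in particular for g near 1. *)
Definition sl2_act (g : 'M[R]_2) (p : jet R 0) : jet R 0 :=
  \row_(j < 2)
    (if j == 0 then (g 0 0 * p 0 0 + g 0 1) / (g 1 0 * p 0 0 + g 1 1)
     else p 0 1).

Definition one_param_subgroup (g : R -> 'M[R]_2) : Prop :=
  [/\ forall t, SL2 (g t),
      forall s t, g (s + t) = g s *m g t &
      forall t, derivable g t 1].

Definition sl2_generators : set (vfield R) :=
  [set v | exists2 g, one_param_subgroup g &
     forall p, is_derive (0 : R) 1 (fun t => sl2_act (g t) p) (v p)].

(* Dimension of the group, as the dimension of its tangent space at 1. *)
Definition dim_SL2 : nat :=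
  span_dim [set 'D_1 g 0 | g in one_param_subgroup].

(* The vector field c(x) d/dx. *)
Definition dx_field (c : R -> R) : vfield R :=
  fun p => c (p 0 0) *: delta_mx 0 0.

End SL2.

Arguments sl2_generators : clear implicits.
Arguments dim_SL2 : clear implicits.

(* Main.v *)
Require Import Defs.
From mathcomp Require Import all_boot all_order all_algebra.
From mathcomp Require Import all_classical all_reals all_analysis.
From mathcomp Require Import ring lra zify.
Import Order.TTheory GRing.Theory Num.Theory numFieldNormedType.Exports.

(** The one-parameter subgroups of SL(2) generate exactly the fields
    xi(x) d/dx with xi a polynomial of degree at most 2 ([sl2_generatorsE]).
    For such a field D_x^k (- xi u_(1)) is given by the Leibniz rule, and all
    terms with a derivative of xi of order 3 or more vanish; so at a point z
    the prolongation is xi E - xi' A - xi'' B, where E = d/dx and A, B depend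
    only on z ([prolong_quad]).  As xi, xi', xi'' take arbitrary values at one
    point, the tangent space of the orbit of z is the span of E, A and B.  The
    components of these vectors along x, u_(1), u_(2) form a triangular matrix
    with diagonal 1, u_(1), u_(1), whence the generic dimension min (n + 1, 3)
    ([s_sl2]) and, for n <= 2, the description of the generic points.

    The differentials of invariants vanish on this tangent space, so at most
    n + 2 - s_n of them are independent ([independent_bound]).  The bound is
    attained: u is an invariant, and where u_(1) does not vanish a unique
    homography that fixes the abscissa x brings the Taylor expansion of u at x
    to the form u + X + 0 X^2 + ..., the remaining coefficients being
    invariants ([normalized_invariant]).  The one of order k involves u_(k)
    linearly and no derivative of higher order, so their Jacobian is
    triangular ([i_sl2]).  The first of them is a sixth of
    K = (2 u_(1) u_(3) - 3 u_(2)^2) / (2 u_(1)^4), the Schwarzian derivative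
    up to a power of u_(1).

    For n <= 3, where u_(1) does not vanish, x, u, u_(1), u_(2), K are
    coordinates (as many of them as make sense at order n), and the orbits are
    locally the fibres of (u, K).  An invariant
    defined near z is therefore constant along the curves on which u and K are
    fixed and x, u_(1), u_(2) vary linearly ([invariant_on_fibre]); moving
    x, u_(1), u_(2) back to their values at z expresses it through u and K
    ([invariant_reduction]).  On that slice u_(3) is an affine function of K,
    so the expression is smooth. *)

Set Implicit Arguments.
Unset Strict Implicit.
Unset Printing Implicit Defensive.

Local Open Scope classical_set_scope.
Local Open Scope ring_scope.

(** * Functions of class C^k of several real variables *)

Section SmoothCalculus.
Context {R : realType}.

Lemma cvg_row (T : Type) (F : set_system T) {FF : Filter F} n
    (g : 'I_n -> T -> R) (l : 'I_n -> R) :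
  (forall j, g j x @[x --> F] --> l j) ->
  (\row_j g j x) @[x --> F] --> \row_j l j.
Proof.
move=> gl A [P nP PA].
have H : \forall x \near F, forall j, P 0 j (g j x).
  apply: filter_forall => j; apply: gl.
  by have := nP 0 j; rewrite mxE.
rewrite /fmap /nbhs /=; apply: filterS H => x H.
by apply: PA => i j; rewrite mxE (ord1 i).
Qed.

Lemma differentiable_row (V : normedModType R) n (g : 'I_n -> V -> R) (p : V) :
  (forall j, differentiable (g j) p) ->
  differentiable (fun q => \row_j g j q) p.
Proof.
move=> dg.
have -> : (fun q => \row_j g j q) =
    \sum_j (fun q => g j q *: (delta_mx 0 j : 'rV[R]_n)).
  apply/funext => q; rewrite fct_sumE [LHS]row_sum_delta.
  by apply: eq_bigr => j _; rewrite mxE.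
apply: differentiable_sum => j; exact: differentiableZl.
Qed.

Lemma derive_row (V : normedModType R) n (g : 'I_n -> V -> R) (p v : V) :
  (forall j, differentiable (g j) p) ->
  'D_v (fun q => \row_j g j q) p = \row_j 'D_v (g j) p.
Proof.
move=> dg; have dr : derivable (fun q => \row_j g j q) p v.
  exact/diff_derivable/differentiable_row.
rewrite (derive_mx dr); apply/rowP => j; rewrite !mxE.
apply: (congr1 (fun h => 'D_v h p)).
by apply/funext => q; rewrite mxE.
Qed.

Lemma derive_coord n (f : 'rV[R]_n -> R) (p h : 'rV[R]_n) :
  differentiable f p -> 'D_h f p = \sum_i h 0 i * pderiv i f p.
Proof.
move=> df; rewrite deriveE // {1}(row_sum_delta h) raddf_sum /=.
by apply: eq_bigr => i _; rewrite linearZ /= /pderiv deriveE.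
Qed.

Lemma chain_row (V : normedModType R) n (f : 'rV[R]_n -> R)
    (g : 'I_n -> V -> R) (p v : V) :
  (forall j, differentiable (g j) p) ->
  differentiable f (\row_j g j p) ->
  'D_v (fun q => f (\row_j g j q)) p =
    \sum_j 'D_v (g j) p * pderiv j f (\row_j g j p).
Proof.
move=> dg df.
have dG : differentiable (fun q => \row_j g j q) p by exact: differentiable_row.
rewrite deriveE; last exact: (differentiable_comp dG df).
rewrite (diff_comp dG df) /= -!deriveE //.
rewrite derive_row // derive_coord //.
by apply: eq_bigr => j _; rewrite mxE.
Qed.

(** The linear map that approximates f at p also approximates g, because the
    two increments agree near p. *)
Lemma near_eq_differentiable (V W : normedModType R) (f g : V -> W) (p : V) :
  (\near p, f p = g p) -> differentiable f p -> differentiable g p.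
Proof.
move=> fg df; have dfc : continuous ('d f p) by exact: diff_continuous.
suff H : g \o shift p = cst (g p) + 'd f p +o_ 0 id.
  have /= E := diff_unique dfc H.
  by apply/diff_locallyP; rewrite E.
have := diff_locally df; move/eqaddoP => fo; apply/eqaddoP => e e0.
have {}fo := fo e e0; near=> h.
have : `|(f \o shift p - (cst (f p) + 'd f p)) h| <= e * `|h| by near: h.
rewrite /= !fctE /= (nbhs_singleton fg).
suff -> : f (h + p) = g (h + p) by [].
near: h.
by move: fg; rewrite (near_shift 0) /=; apply: filterS => h; rewrite subr0.
Unshelve. all: by end_near. Qed.

Lemma derive_entry n (i : 'I_n) (p h : 'rV[R]_n) :
  'D_h (fun q : 'rV[R]_n => q 0 i) p = h 0 i.
Proof.
rewrite -[in RHS](@derive_id _ _ p h) derive_mx; first by rewrite mxE.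
exact: derivable_id.
Qed.

Section Ck.
Context {n : nat}.
Implicit Types (U : set 'rV[R]_n) (f g : 'rV[R]_n -> R).

Lemma near_of_open U f g p : open U -> {in U, f =1 g} -> U p ->
  \near p, f p = g p.
Proof.
move=> oU fg Up; have : nbhs p U by exact: open_nbhs_nbhs.
by apply: filterS => q Uq; apply: fg; rewrite inE.
Qed.

Lemma Ck_on_ext U f g k : open U -> {in U, f =1 g} ->
  Ck_on k U f -> Ck_on k U g.
Proof.
move=> oU; elim: k f g => [|k IH] f g fg /=.
  move=> cf p Up; rewrite /prop_for /continuous_at -(fg p) ?inE //.
  exact: cvg_trans (near_eq_cvg (near_of_open oU fg Up)) (cf p Up).
case=> df pf; split=> [p Up|i].
  by apply: near_eq_differentiable (df p Up); exact: near_of_open oU fg Up.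
apply: IH (pf i) => p; rewrite inE => Up; apply: near_eq_derive.
exact: near_of_open oU fg Up.
Qed.

Lemma Ck_onW U f k : Ck_on k.+1 U f -> Ck_on k U f.
Proof.
elim: k f => [|k IH] f [df pf] /=.
  by move=> p Up; exact: differentiable_continuous (df p Up).
by split=> // i; exact: IH.
Qed.

Lemma Ck_onD U f g k : open U -> Ck_on k U f -> Ck_on k U g ->
  Ck_on k U (fun p => f p + g p).
Proof.
move=> oU; elim: k f g => [|k IH] f g /=.
  by move=> cf cg p Up; exact: cvgD (cf p Up) (cg p Up).
move=> [df pf] [dg pg]; split=> [p Up|i].
  by exact: differentiableD (df p Up) (dg p Up).
apply: Ck_on_ext (IH _ _ (pf i) (pg i)) => // p; rewrite inE => Up.
by rewrite /pderiv deriveD //; apply: diff_derivable; [exact: df | exact: dg].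
Qed.

Lemma Ck_onM U f g k : open U -> Ck_on k U f -> Ck_on k U g ->
  Ck_on k U (fun p => f p * g p).
Proof.
move=> oU; elim: k f g => [|k IH] f g.
  by move=> cf cg p Up; exact: cvgM (cf p Up) (cg p Up).
move=> Cf Cg; have [df pf] := Cf; have [dg pg] := Cg; split=> [p Up|i].
  by exact: differentiableM (df p Up) (dg p Up).
apply: Ck_on_ext (Ck_onD oU (IH _ _ (Ck_onW Cf) (pg i))
                            (IH _ _ (Ck_onW Cg) (pf i))) => // p.
rewrite inE => Up.
by rewrite /pderiv deriveM //; apply: diff_derivable; [exact: df | exact: dg].
Qed.

Lemma Ck_on_cst U (a : R) k : Ck_on k U (fun=> a).
Proof.
elim: k a => [|k IH] a /=; first by move=> p _; exact: cst_continuous.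
split=> [p _|i]; first exact: differentiable_cst.
suff -> : pderiv i (fun=> a) = (fun=> 0) by exact: IH.
by apply/funext => p; rewrite /pderiv derive_cst.
Qed.

Lemma Ck_onN U f k : open U -> Ck_on k U f -> Ck_on k U (fun p => - f p).
Proof.
move=> oU Cf; rewrite (_ : (fun _ => _) = fun p => -1 * f p).
  by apply: Ck_onM => //; exact: Ck_on_cst.
by apply/funext => p; rewrite mulN1r.
Qed.

Lemma Ck_on_sum U (I : Type) (s : seq I) (f : I -> 'rV[R]_n -> R) k : open U ->
  (forall i, Ck_on k U (f i)) -> Ck_on k U (fun p => \sum_(i <- s) f i p).
Proof.
move=> oU Cf; elim: s => [|i s IH].
  rewrite (_ : (fun _ => _) = fun=> 0); first exact: Ck_on_cst.
  by apply/funext => p; rewrite big_nil.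
rewrite (_ : (fun _ => _) = fun p => f i p + \sum_(j <- s) f j p).
  exact: Ck_onD.
by apply/funext => p; rewrite big_cons.
Qed.

Lemma Ck_onV U f k : open U -> (forall p, U p -> f p != 0) ->
  Ck_on k U f -> Ck_on k U (fun p => (f p)^-1).
Proof.
move=> oU f0; elim: k => [|k IH].
  by move=> cf p Up; exact: cvgV (f0 p Up) (cf p Up).
move=> Cf; have [df pf] := Cf; have CV := IH (Ck_onW Cf).
split=> [p Up|i].
  by exact: differentiableV (df p Up) (f0 p Up).
have CN : Ck_on k U (fun=> -1 : R) by exact: Ck_on_cst.
apply: Ck_on_ext (Ck_onM oU CN (Ck_onM oU (Ck_onM oU CV CV) (pf i))) => // p.
rewrite inE => Up; rewrite /pderiv deriveV ?f0 //.
  by rewrite mulN1r scaleNr expr2 invfM.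
by apply: diff_derivable; exact: df.
Qed.

Lemma Ck_onX U f k m : open U -> Ck_on k U f -> Ck_on k U (fun p => f p ^+ m).
Proof.
move=> oU Cf; elim: m => [|m IH].
  by rewrite (_ : (fun _ => _) = fun=> 1) //; exact: Ck_on_cst.
rewrite (_ : (fun _ => _) = fun p => f p * f p ^+ m); first exact: Ck_onM.
by apply/funext => p; rewrite exprS.
Qed.

Lemma Ck_on_coord U (i : 'I_n) k : Ck_on k U (fun p => p 0 i).
Proof.
case: k => [|k] /=; first by move=> p _; exact: coord_continuous.
split=> [p _|j]; first exact: differentiable_coord.
rewrite (_ : pderiv j _ = fun=> (delta_mx 0 j : 'rV[R]_n) 0 i).
  exact: Ck_on_cst.
by apply/funext => p; exact: derive_entry.
Qed.

Lemma Ck_onS U V f k : U `<=` V -> Ck_on k V f -> Ck_on k U f.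
Proof.
move=> UV; elim: k f => [|k IH] f /=; first by move=> cf p /UV /cf.
by case=> df pf; split=> [p /UV /df //|i]; exact: IH.
Qed.
End Ck.

(** By the chain rule a partial derivative of the composite is a sum of
    products of a partial derivative of an inner function with the composite
    of a partial derivative of f, which is of one class less. *)
Lemma Ck_on_comp n m (U : set 'rV[R]_n) (O : set 'rV[R]_m) (f : 'rV[R]_m -> R)
    (g : 'I_m -> 'rV[R]_n -> R) k : open U ->
  (forall p, U p -> O (\row_j g j p)) ->
  Ck_on k O f -> (forall j, Ck_on k U (g j)) ->
  Ck_on k U (fun p => f (\row_j g j p)).
Proof.
move=> oU UO; elim: k f => [|k IH] f.
  move=> cf cg p Up; apply: continuous_comp; last exact: cf (UO _ Up).
  exact: (cvg_row (F := nbhs p) (fun j => cg j p Up)).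
move=> [df pf] Cg; split=> [p Up|i].
  apply: differentiable_comp (df _ (UO _ Up)).
  by apply: differentiable_row => j; exact: (Cg j).1.
have C' : Ck_on k U (fun p => \sum_j pderiv i (g j) p * pderiv j f (\row_j g j p)).
  apply: Ck_on_sum => // j; apply: Ck_onM => //; first exact: (Cg j).2.
  by apply: IH; [exact: pf | move=> l; exact: Ck_onW].
apply: Ck_on_ext C' => // p; rewrite inE => Up.
apply/esym/chain_row; last exact: (df _ (UO _ Up)).
by move=> j; exact: (Cg j).1.
Qed.

(** Mean value theorem for the composite of f with the curve. *)
Lemma constant_along_curve n (U : set 'rV[R]_n) (f : 'rV[R]_n -> R)
    (c dc : 'I_n -> R -> R) :
  (forall p, U p -> differentiable f p) ->
  (forall s : R, s \in `[0, 1] -> U (\row_j c j s)) ->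
  (forall s : R, s \in `[0, 1] -> forall j, is_derive s 1 (c j) (dc j s)) ->
  (forall s : R, s \in `[0, 1] -> 'D_(\row_j dc j s) f (\row_j c j s) = 0) ->
  f (\row_j c j 0) = f (\row_j c j 1).
Proof.
move=> df cU dcE d0; pose g s := f (\row_j c j s).
have gdiff (s : R) : s \in `[0, 1] -> differentiable g s.
  move=> s01; apply: differentiable_comp (df _ (cU s s01)).
  apply: differentiable_row => j; apply/derivable1_diffP.
  by have [] := dcE s s01 j.
have g0 (s : R) : s \in `[0, 1] -> 'D_1 g s = 0.
  move=> s01; rewrite -(d0 s s01) chain_row; last exact: df (cU s s01).
    rewrite derive_coord; last exact: df (cU s s01).
    by apply: eq_bigr => j _; rewrite mxE (@derive_val _ _ _ _ _ _ _ (dcE s s01 j)).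
  by move=> j; apply/derivable1_diffP; have [] := dcE s s01 j.
have [||x x01] := @MVT_segment R g (fun=> 0) 0 1 ler01.
- move=> x /subset_itv_oo_cc x01; rewrite -(g0 x x01).
  by apply: derivableP; apply/derivable1_diffP; exact: gdiff.
- apply: derivable_within_continuous => x x01.
  by apply/derivable1_diffP; exact: gdiff.
by rewrite mul0r => /eqP; rewrite subr_eq0 => /eqP /esym.
Qed.

(** The rules below are stated for functions given by explicit expressions,
    so that unification can follow the expression to be differentiated. *)
Section DerivativeRules.
Context {V : normedModType R}.
Implicit Types (f g : V -> R) (x v : V).

Lemma dfun_val f x v df d : is_derive x v f df -> df = d -> 'D_v f x = d.
Proof. by move=> [_ ->] ->. Qed.

Lemma dfun_cst (a : R) x v : is_derive x v (fun=> a) 0.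
Proof. exact: is_derive_cst. Qed.

Lemma dfun_add f g x v df dg : is_derive x v f df -> is_derive x v g dg ->
  is_derive x v (fun y => f y + g y) (df + dg).
Proof. by move=> fd gd; exact: is_deriveD. Qed.

Lemma dfun_opp f x v df : is_derive x v f df ->
  is_derive x v (fun y => - f y) (- df).
Proof. by move=> fd; exact: is_deriveN. Qed.

Lemma dfun_mul f g x v df dg : is_derive x v f df -> is_derive x v g dg ->
  is_derive x v (fun y => f y * g y) (f x * dg + g x * df).
Proof. by move=> fd gd; exact: is_deriveM. Qed.

Lemma dfun_inv f x v df : is_derive x v f df -> f x != 0 ->
  is_derive x v (fun y => (f y)^-1) (- (f x)^-1 ^+ 2 * df).
Proof.
move=> fd f0; split; first exact: derivableV.
by rewrite deriveV // derive_val exprVn.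
Qed.

Lemma dfun_exp f x v df n : is_derive x v f df ->
  is_derive x v (fun y => f y ^+ n) (n%:R * f x ^+ n.-1 * df).
Proof.
move=> fd; elim: n => [|n IH].
  by rewrite !mul0r (_ : (fun _ => _) = fun=> 1) //; exact: dfun_cst.
rewrite (_ : (fun _ => _) = fun y => f y * f y ^+ n); last first.
  by apply/funext => y; rewrite exprS.
apply: is_derive_eq (dfun_mul fd IH) _; case: n {IH} => [|n] /=; first by ring.
by rewrite !exprS -!natr1; ring.
Qed.

Lemma dfun_sum (I : Type) (s : seq I) (f : I -> V -> R) x v (df : I -> R) :
  (forall i, is_derive x v (f i) (df i)) ->
  is_derive x v (fun y => \sum_(i <- s) f i y) (\sum_(i <- s) df i).
Proof.
move=> fd; elim: s => [|i s IH].
  rewrite big_nil (_ : (fun _ => _) = fun=> 0); first exact: dfun_cst.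
  by apply/funext => y; rewrite big_nil.
rewrite big_cons (_ : (fun _ => _) = fun y => f i y + \sum_(j <- s) f j y).
  exact: dfun_add.
by apply/funext => y; rewrite big_cons.
Qed.
End DerivativeRules.

Lemma dfun_comp (f g : R -> R) (x df dg : R) :
  is_derive x 1 f df -> is_derive (f x) 1 g dg ->
  is_derive x 1 (fun y => g (f y)) (dg * df).
Proof.
move=> [fd fE] [gd gE].
have fd1 : differentiable f x := (derivable1_diffP f x).1 fd.
have gd1 : differentiable g (f x) := (derivable1_diffP g (f x)).1 gd.
have hd : differentiable (g \o f) x := differentiable_comp fd1 gd1.
split; first exact: (derivable1_diffP (g \o f) x).2 hd.
by have := derive1_comp fd gd; rewrite !derive1E fE gE.
Qed.
End SmoothCalculus.

(** Both tactics follow the structure of an expression; the argument is the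
    tactic that deals with its atoms. *)
Ltac der_rules leaf := repeat first
  [ leaf | eapply dfun_cst | eapply dfun_add | eapply dfun_opp | eapply dfun_mul
  | eapply dfun_exp ].

Ltac Ck_rules leaf := repeat first
  [ exact: openT | leaf | apply: Ck_on_cst | apply: Ck_onD | apply: Ck_onN
  | apply: Ck_onM | apply: Ck_onX ].

(** * Prolonged quadratic vector fields *)

Section Prolongation.
Context {R : realType}.

Lemma jcoordE n (z : jet R n) (i : 'I_n.+2) : jcoord z i = z 0 i.
Proof. by rewrite /jcoord valK. Qed.

Lemma jcoord_row n (E : nat -> R) k : (k < n.+2)%N ->
  @jcoord R n (\row_(i < n.+2) E i) k = E k.
Proof. by move=> kn; rewrite (jcoordE _ (Ordinal kn)) mxE. Qed.

Lemma jcoord_resize n m (z : jet R n) i : (i < m.+2)%N ->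
  jcoord (jresize m z) i = jcoord z i.
Proof. exact: jcoord_row. Qed.

Lemma jet_eq n (z w : jet R n) :
  (forall i, (i < n.+2)%N -> jcoord z i = jcoord w i) -> z = w.
Proof. by move=> zw; apply/rowP => i; rewrite -!jcoordE; exact: zw. Qed.

Lemma jcoordD n (z w : jet R n) i : jcoord (z + w) i = jcoord z i + jcoord w i.
Proof. by rewrite /jcoord; case: insub => [j|]; rewrite ?mxE ?addr0. Qed.

Lemma jcoordZ n a (z : jet R n) i : jcoord (a *: z) i = a * jcoord z i.
Proof. by rewrite /jcoord; case: insub => [j|]; rewrite ?mxE ?mulr0. Qed.

Lemma jcoord0 n i : jcoord (0 : jet R n) i = 0.
Proof. by rewrite /jcoord; case: insub => [j|]; rewrite ?mxE. Qed.

Lemma dfun_jcoord n i (p h : jet R n) :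
  is_derive p h (fun q : jet R n => jcoord q i) (jcoord h i).
Proof.
rewrite /jcoord; case: insubP => [i' _ _|_]; last exact: dfun_cst.
split; last exact: derive_entry.
by apply/diff_derivable/differentiable_coord.
Qed.

Lemma Ck_on_jcoord n i k (U : set (jet R n)) :
  Ck_on k U (fun q : jet R n => jcoord q i).
Proof.
rewrite /jcoord; case: insubP => [i' _ _|_]; first exact: Ck_on_coord.
exact: Ck_on_cst.
Qed.

Lemma differentiable_jcoord n i (p : jet R n) :
  differentiable (fun q : jet R n => jcoord q i) p.
Proof. by have [/(_ p I)] := @Ck_on_jcoord n i 1 setT. Qed.

(** The coefficients of D_x are the components of a vector at the projected
    point, so D_x F is a directional derivative. *)
Lemma total_derivE m (F : jet R m -> R) (z : jet R m.+1) :
  differentiable F (jresize m z) ->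
  total_deriv F z =
    'D_(\row_(i < m.+2) (if (i : nat) is j.+1 then ju j.+1 z else 1)) F
      (jresize m z).
Proof.
move=> dF; rewrite derive_coord // big_ord_recl mxE mul1r; congr (_ + _).
by apply: eq_bigr => k _; rewrite mxE.
Qed.

Definition quad_field (a b c : R) : vfield R :=
  dx_field (fun x => a + b * x + c * x ^+ 2).

Lemma xi_quad a b c (p : jet R 0) :
  xi (quad_field a b c) p = a + b * jcoord p 0 + c * jcoord p 0 ^+ 2.
Proof. by rewrite /xi /quad_field /dx_field !mxE eqxx mulr1 (jcoordE p 0). Qed.

Lemma phi_quad a b c (p : jet R 0) : phi (quad_field a b c) p = 0.
Proof. by rewrite /phi /quad_field /dx_field !mxE mulr0. Qed.

(** Leibniz rule for D_x^k (- xi u_(1)) with xi = a + b x + c x^2; the factor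
    k choose 2 vanishes when the last coordinate is not a derivative of u. *)
Lemma iter_total_deriv_quad a b c k (z : jet R k.+1) :
  iter_total_deriv (quad_field a b c) z =
  - ((a + b * jcoord z 0 + c * jcoord z 0 ^+ 2) * jcoord z k.+2 +
     k%:R * (b + 2 * c * jcoord z 0) * jcoord z k.+1 +
     'C(k, 2)%:R * (2 * c) * jcoord z k).
Proof.
elim: k z => [|k IH] z /=.
  rewrite /charQ phi_quad xi_quad jcoord_resize // /ju bin_small //; ring.
have -> : iter_total_deriv (quad_field a b c) (k := k) = fun z => 
  - ((a + b * jcoord z 0 + c * jcoord z 0 ^+ 2) * jcoord z k.+2 +
     k%:R * (b + 2 * c * jcoord z 0) * jcoord z k.+1 +
     'C(k, 2)%:R * (2 * c) * jcoord z k) by apply/funext.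
rewrite total_derivE; last first.
  suff [/(_ _ I)] : Ck_on 1 setT (fun z : jet R k.+1 =>
    - ((a + b * jcoord z 0 + c * jcoord z 0 ^+ 2) * jcoord z k.+2 +
     k%:R * (b + 2 * c * jcoord z 0) * jcoord z k.+1 +
     'C(k, 2)%:R * (2 * c) * jcoord z k)) by [].
  by Ck_rules ltac:(apply: Ck_on_jcoord).
set h := \row_(i < _) _; set p := jresize _ z.
have pE i : (i < k.+3)%N -> jcoord p i = jcoord z i by exact: jcoord_resize.
have hE i : (i < k.+3)%N -> jcoord h i = if i is j.+1 then jcoord z j.+2 else 1.
  move=> ik.
  by rewrite [LHS](jcoord_row (fun i => if i is j.+1 then ju j.+1 z else 1)).
eapply dfun_val; first by der_rules ltac:(eapply dfun_jcoord).
have k3 : (k < k.+3)%N by lia.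
rewrite !hE // !pE // -natr1.
rewrite (_ : 'C(k.+1, 2) = 'C(k, 2) + k)%N; last by rewrite binS bin1.
rewrite natrD.
case: k {k3 IH pE hE h p} z => [|k] z; last by ring.
by rewrite bin_small //; ring.
Qed.

(** At a point of the jet space, the prolongations of d/dx, of (x - x0) d/dx
    and of (x - x0)^2 d/dx, where x0 is the abscissa of the point, are the
    vector d/dx, minus the first vector below and minus twice the second. *)
Definition dilation_row n (z : jet R n) : jet R n :=
  \row_(i < n.+2) (i.-1%:R * jcoord z i).
Definition inversion_row n (z : jet R n) : jet R n :=
  \row_(i < n.+2) ('C(i.-1, 2)%:R * jcoord z i.-1).

Lemma dilation_coord n (z : jet R n) i : (i < n.+2)%N ->
  jcoord (dilation_row z) i = i.-1%:R * jcoord z i.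
Proof.
by move=> il; rewrite [LHS](jcoord_row (fun i => i.-1%:R * jcoord z i)).
Qed.

Lemma inversion_coord n (z : jet R n) i : (i < n.+2)%N ->
  jcoord (inversion_row z) i = 'C(i.-1, 2)%:R * jcoord z i.-1.
Proof.
by move=> il; rewrite [LHS](jcoord_row (fun i => 'C(i.-1, 2)%:R * jcoord z i.-1)).
Qed.

Lemma delta_coord n (j : 'I_n.+2) i :
  jcoord (delta_mx 0 j : jet R n) i = (i == j)%:R.
Proof.
rewrite /jcoord; case: insubP => [i' _ <-|]; first by rewrite mxE.
by case: eqP => // ->; rewrite ltn_ord.
Qed.

Lemma prolong_quad n a b c (z : jet R n) :
  let x := jcoord z 0 in
  prolong (quad_field a b c) z =
    (a + b * x + c * x ^+ 2) *: delta_mx 0 0 +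
    (- (b + 2 * c * x) *: dilation_row z + - (2 * c) *: inversion_row z).
Proof.
move=> x; apply/rowP => -[[|k] kn]; rewrite !mxE /=.
  by rewrite xi_quad jcoord_resize // bin_small // -/x; ring.
rewrite /phi_k iter_total_deriv_quad xi_quad /ju !jcoord_resize // -/x;
  first ring.
by lia.
Qed.

End Prolongation.

(** * One-parameter subgroups of SL(2) *)

Lemma nat_max_eq (P : set nat) k :
  P k -> (forall m, P m -> (m <= k)%N) -> nat_max P = k.
Proof.
move=> Pk kmax; rewrite /nat_max.
have [Pm mmax] : [set k | P k /\ forall m, P m -> (m <= k)%N] (nat_max P).
  by apply: xgetPex; exists k.
by apply/eqP; rewrite eqn_leq kmax // mmax.
Qed.

Lemma span_dim_vspace (F : fieldType) (V : vectType F) (W : {vspace V}) :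
  span_dim [set x | x \in W] = (\dim W)%N.
Proof.
apply: nat_max_eq.
  exists (vbasis W); split=> [x|]; first exact: vbasis_mem.
  by rewrite (span_basis (vbasisP W)).
by move=> _ [X [XW ->]]; apply/dimvS/span_subvP => x /XW.
Qed.

Section Generators.
Context {R : realType}.

(** C and S are cos and sin, 1 and the identity, or cosh and sinh, up to
    scaling, according to the sign of d.  If X is a square matrix with
    X^2 = d then exp (t X) = C t + S t X. *)
Lemma unit_hyperbola_flow (d : R) : exists C S : R -> R,
  [/\ C 0 = 1 /\ S 0 = 0,
      forall s t, C (s + t) = C s * C t + d * (S s * S t),
      forall s t, S (s + t) = C s * S t + S s * C t,
      forall t, C t ^+ 2 - d * S t ^+ 2 = 1 &
      forall t : R, is_derive t 1 C (d * S t) /\ is_derive t 1 S (C t)].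
Proof.
have lin (r t : R) : is_derive t 1 (fun t : R => r * t) r.
  apply: is_derive_eq (dfun_mul (dfun_cst r t 1) (is_derive_id t 1)) _; ring.
have [d0|d0|->] := ltgtP d 0.
- pose r := Num.sqrt (- d).
  have r0 : r != 0 by rewrite sqrtr_eq0 -ltNge oppr_gt0.
  have dE : d = - r ^+ 2 by rewrite sqr_sqrtr ?opprK // oppr_ge0 ltW.
  have dc (t : R) : is_derive t 1 (fun t : R => cos (r * t)) (- r * sin (r * t)).
    by apply: is_derive_eq (dfun_comp (lin r t) (is_derive_cos _)) _; ring.
  have ds (t : R) : is_derive t 1 (fun t : R => sin (r * t)) (r * cos (r * t)).
    by apply: is_derive_eq (dfun_comp (lin r t) (is_derive_sin _)) _; ring.
  exists (fun t => cos (r * t)), (fun t => sin (r * t) * r^-1); split.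
  + by rewrite !mulr0 cos0 sin0 mul0r.
  + by move=> s t; rewrite mulrDr cosD dE; field.
  + by move=> s t; rewrite mulrDr sinD; field.
  + by move=> t; rewrite dE -(cos2Dsin2 (r * t)); field.
  + move=> t; split; first by apply: is_derive_eq (dc t) _; rewrite dE; field.
    by apply: is_derive_eq (dfun_mul (ds t) (dfun_cst r^-1 t 1)) _; field.
- pose r := Num.sqrt d.
  have r0 : r != 0 by rewrite sqrtr_eq0 -ltNge.
  have dE : d = r ^+ 2 by rewrite sqr_sqrtr // ltW.
  pose e t := expR (r * t); pose f t := expR (- r * t).
  have de (t : R) : is_derive t 1 e (r * e t).
    apply: is_derive_eq (dfun_comp (lin r t) (is_derive_expR _)) _.
    by rewrite /e; ring.
  have df (t : R) : is_derive t 1 f (- r * f t).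
    apply: is_derive_eq (dfun_comp (lin (- r) t) (is_derive_expR _)) _.
    by rewrite /f; ring.
  have eD s t : e (s + t) = e s * e t by rewrite /e mulrDr expRD.
  have fD s t : f (s + t) = f s * f t by rewrite /f mulrDr expRD.
  have ef t : e t * f t = 1.
    by rewrite /e /f mulNr expRN divff // gt_eqF // expR_gt0.
  exists (fun t => (e t + f t) * 2^-1), (fun t => (e t - f t) * (2 * r)^-1); split.
  + by rewrite /e /f !mulr0 expR0; split; field.
  + by move=> s t; rewrite eD fD dE; field.
  + by move=> s t; rewrite eD fD; field.
  + by move=> t; rewrite dE -[RHS](ef t); field.
  + move=> t; split; (eapply is_derive_eq;
      first by der_rules ltac:(first [exact: de | exact: df]));
      rewrite /= ?dE; field; exact: r0.
- exists (fun=> 1), id; split => //.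
  + by move=> s t; ring.
  + by move=> s t; ring.
  + by move=> t; ring.
  + by move=> t; rewrite mul0r; split; [exact: is_derive_cst | exact: is_derive_id].
Qed.

(** The general element of the Lie algebra: a matrix of trace 0. *)
Definition sl2_mx (p q r : R) : 'M[R]_2 := \matrix_(i < 2, j < 2)
  if i == 0 then (if j == 0 then p else q) else (if j == 0 then r else - p).

Lemma ord2 (i : 'I_2) : i = 0 \/ i = 1.
Proof. by case: i => -[|[|//]] h; [left | right]; exact/val_inj. Qed.

Lemma det2 (A : 'M[R]_2) : \det A = A 0 0 * A 1 1 - A 0 1 * A 1 0.
Proof.
rewrite (expand_det_row _ 0) !big_ord_recl big_ord0 /cofactor !det_mx11 !mxE.
have E0 : lift (0 : 'I_2) (0 : 'I_1) = 1 by exact/val_inj.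
have E1 : lift (1 : 'I_2) (0 : 'I_1) = 0 by exact/val_inj.
by rewrite !E0 !E1 /= expr0 expr1; ring.
Qed.

(** The exponential is explicit, because the square of a 2 x 2 matrix of
    trace 0 is the scalar - det. *)
Lemma sl2_mx_one_param p q r :
  exists2 g, one_param_subgroup g & 'D_1 g (0 : R) = sl2_mx p q r.
Proof.
have [C [S [[C0 S0] CD SD CS1 dCS]]] := unit_hyperbola_flow (p ^+ 2 + q * r).
pose g t : 'M[R]_2 := C t *: 1%:M + S t *: sl2_mx p q r.
have dg (t : R) i j : is_derive t 1 (fun t => g t i j)
    ((p ^+ 2 + q * r) * S t * (1%:M : 'M[R]_2) i j + C t * sl2_mx p q r i j).
  have [dC dS] := dCS t.
  rewrite (_ : (fun _ => _) =
    fun t => C t * (1%:M : 'M[R]_2) i j + S t * sl2_mx p q r i j); last first.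
    by apply/funext => s; rewrite !mxE.
  eapply is_derive_eq; first by der_rules ltac:(first [exact: dC | exact: dS]).
  by rewrite /=; ring.
have gd (t : R) : derivable g t 1.
  by apply/derivable_mxP => i j; have [] := dg t i j.
exists g; last first.
  rewrite derive_mx //; apply/matrixP => i j; rewrite mxE.
  by have [_ ->] := dg 0 i j; rewrite C0 S0; ring.
split => //.
- move=> t; rewrite /SL2 /= det2 !mxE /= -[RHS](CS1 t); ring.
- move=> s t; apply/matrixP => -[[|[|//]] ilt] -[[|[|//]] jlt];
    rewrite !mxE !big_ord_recl big_ord0 !mxE /= CD SD; ring.
Qed.

(** Differentiating det = 1 at the identity shows that the trace of X is 0,
    and differentiating the homography gives X01 + (X00 - X11) x - X10 x^2. *)
Lemma one_param_generator g (p : jet R 0) : one_param_subgroup g ->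
  let X : 'M[R]_2 := 'D_1 g (0 : R) in
  X 1 1 = - X 0 0 /\ is_derive (0 : R) 1 (fun t => sl2_act (g t) p)
    (quad_field (X 0 1) (2 * X 0 0) (- X 1 0) p).
Proof.
move=> [gSL gD gd] X.
have g0 : g 0 = 1%:M.
  have g0u : g 0 \in unitmx by rewrite unitmxE (gSL 0 : \det _ = 1) unitr1.
  by rewrite -(mulKmx g0u (g 0)) -gD addr0 mulVmx.
have dX i j : is_derive (0 : R) 1 (fun t => g t i j) (X i j).
  split; first by have /derivable_mxP := gd 0; apply.
  by rewrite /X derive_mx // mxE.
have trX : X 1 1 = - X 0 0.
  have : is_derive (0 : R) 1 (fun t => g t 0 0 * g t 1 1 - g t 0 1 * g t 1 0)
    (X 0 0 + X 1 1).
    eapply is_derive_eq; first by der_rules ltac:(eapply dX).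
    by rewrite /= g0 !mxE /=; ring.
  rewrite (_ : (fun _ => _) = fun=> 1); last first.
    by apply/funext => t; rewrite -det2; exact: gSL.
  by move=> [_]; rewrite derive_cst; lra.
split => //.
have dact j : is_derive (0 : R) 1 (fun t => sl2_act (g t) p 0 j)
  (quad_field (X 0 1) (2 * X 0 0) (- X 1 0) p 0 j).
  have -> : (fun t => sl2_act (g t) p 0 j) = fun t =>
      if j == 0 then (g t 0 0 * p 0 0 + g t 0 1) / (g t 1 0 * p 0 0 + g t 1 1)
      else p 0 1 by apply/funext => t; rewrite mxE.
  rewrite !mxE eqxx /=; case: (j == 0); last first.
    by rewrite mulr0; exact: dfun_cst.
  have dlin i : is_derive (0 : R) 1 (fun t => g t i 0 * p 0 0 + g t i 1)
      (p 0 0 * X i 0 + X i 1).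
    eapply is_derive_eq; first by der_rules ltac:(eapply dX).
    by rewrite /=; ring.
  have den0 : g 0 1 0 * p 0 0 + g 0 1 1 != 0.
    by rewrite g0 !mxE /= mul0r add0r oner_neq0.
  have dinv := dfun_inv (dlin 1) den0.
  have dquo := dfun_mul (dlin 0) dinv.
  eapply is_derive_eq; first exact: dquo.
  by rewrite /= g0 !mxE /= trX mul0r add0r invr1; ring.
split.
  by apply/derivable_mxP => i j; rewrite (ord1 i); have [] := dact j.
rewrite derive_mx; first by apply/rowP => j; rewrite mxE; have [_ ->] := dact j.
by apply/derivable_mxP => i j; rewrite (ord1 i); have [] := dact j.
Qed.

Lemma sl2_generatorsE :
  sl2_generators R = [set v | exists a b c : R, v = quad_field a b c].
Proof.
apply/seteqP; split=> v.
  move=> [g gs vE]; pose X : 'M[R]_2 := 'D_1 g 0.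
  exists (X 0 1), (2 * X 0 0), (- X 1 0); apply/funext => p.
  have [_ [_ <-]] := one_param_generator p gs.
  by have [_ <-] := vE p.
move=> [a [b [c ->]]]; have [g gs gX] := sl2_mx_one_param (b / 2) a (- c).
exists g => // p; have [_] := one_param_generator p gs.
rewrite gX !mxE /= opprK (_ : 2 * (b / 2) = b) //; by field.
Qed.

Lemma dim_SL2E : dim_SL2 R = 3%N.
Proof.
pose E : seq 'M[R]_2 := [:: sl2_mx 1 0 0; sl2_mx 0 1 0; sl2_mx 0 0 1].
have EE p q r : sl2_mx p q r =
    p *: sl2_mx 1 0 0 + (q *: sl2_mx 0 1 0 + r *: sl2_mx 0 0 1).
  by apply/matrixP => -[[|[|//]] ilt] -[[|[|//]] jlt]; rewrite !mxE /=; ring.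
rewrite /dim_SL2 (_ : [set _ | _ in _] = [set X | X \in <<E>>%VS]).
  rewrite span_dim_vspace; apply/eqP; rewrite -/(free E).
  apply/freeP => k; rewrite !big_ord_recl big_ord0 addr0 /= -EE => k0.
  have k00 i j : sl2_mx (k ord0) (k (lift ord0 ord0))
    (k (lift ord0 (lift ord0 ord0))) i j = 0 by rewrite k0 mxE.
  have := (k00 0 0, k00 0 1, k00 1 0); rewrite !mxE /= => -[[a b] c].
  move=> [[|[|[|//]]] ilt]; [rewrite -[RHS]a | rewrite -[RHS]b | rewrite -[RHS]c];
    by congr (k _); exact/val_inj.
apply/seteqP; split=> X.
  move=> [g gs <-]; have [trX _] := one_param_generator 0 gs.
  set Y : 'M[R]_2 := 'D_1 g 0 in trX *.
  have -> : Y = sl2_mx (Y 0 0) (Y 0 1) (Y 1 0).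
    apply/matrixP => i j.
    by case: (ord2 i) => ->; case: (ord2 j) => ->; rewrite [RHS]mxE /=.
  rewrite EE /=; apply: memvD; last apply: memvD; apply: memvZ;
    by apply: memv_span; rewrite !inE eqxx ?orbT.
move=> /=.
rewrite /E !span_cons span_nil addv0.
move=> /memv_addP[_ /vlineP[p ->] [_ /memv_addP[_ /vlineP[q ->]
  [_ /vlineP[r ->] ->]] ->]].
by have [g gs gX] := sl2_mx_one_param p q r; exists g => //; rewrite gX EE.
Qed.
End Generators.

(** * Orbit dimensions *)

Section Orbits.
Context {R : realType}.
Local Notation gens := (sl2_generators R).

Definition orbit_rows n (z : jet R n) : seq (jet R n) :=
  [:: delta_mx 0 0; dilation_row z; inversion_row z].

(** At a given abscissa the values of xi, xi' and xi'' can be prescribed. *)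
Lemma prolonged_span n (z : jet R n) :
  [set prolong v z | v in gens] = [set w | w \in <<orbit_rows z>>%VS].
Proof.
rewrite sl2_generatorsE /orbit_rows !span_cons span_nil addv0.
apply/seteqP; split=> w.
  move=> [_ [a [b [c ->]]] <-]; rewrite prolong_quad /=.
  by rewrite !memv_add // memvZ // memv_line.
move=> /memv_addP[_ /vlineP[p ->] [_ /memv_addP[_ /vlineP[q ->]
  [_ /vlineP[r ->] ->]] ->]].
pose x := jcoord z 0; pose c := - r / 2; pose b := - q - 2 * c * x.
exists (quad_field (p - b * x - c * x ^+ 2) b c).
  by exists (p - b * x - c * x ^+ 2), b, c.
rewrite prolong_quad -/x; congr (_ *: _ + (_ *: _ + _ *: _)).
- by ring.
- by rewrite /b; ring.
- by rewrite /c; field.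
Qed.

Lemma orbit_dimE n (z : jet R n) :
  orbit_dim gens z = (\dim <<orbit_rows z>>)%N.
Proof. by rewrite /orbit_dim prolonged_span span_dim_vspace. Qed.

Lemma dim_span_le (V : vectType R) (X Y : seq V) :
  {subset X <= <<Y>>%VS} -> (\dim <<X>> <= size Y)%N.
Proof.
move=> XY; apply: leq_trans (dim_span Y).
exact/dimvS/span_subvP.
Qed.

Lemma inversion_row0 n (z : jet R n) :
  (n <= 1)%N || ((n <= 2)%N && (jcoord z 2 == 0)) -> inversion_row z = 0.
Proof.
move=> H; apply: jet_eq => i ilt.
rewrite inversion_coord // jcoord0.
have [i2|i2] := leqP i 2; first by rewrite bin_small ?mul0r //; lia.
have -> : i = 3%N by lia.
have -> : jcoord z 2 = 0 by apply/eqP; lia.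
by rewrite mulr0.
Qed.

Lemma dilation_row0 n (z : jet R n) :
  (n == 0)%N || ((n <= 1)%N && (jcoord z 2 == 0)) -> dilation_row z = 0.
Proof.
move=> H; apply: jet_eq => i ilt.
rewrite dilation_coord // jcoord0.
have [i2|i2] := leqP i 1; first by rewrite (_ : i.-1 = 0%N) ?mul0r //; lia.
have -> : i = 2%N by lia.
have -> : jcoord z 2 = 0 by apply/eqP; lia.
by rewrite mulr0.
Qed.

Lemma orbit_dim_le n (z : jet R n) :
  (orbit_dim gens z <= minn n.+1 3)%N /\
  ((n <= 2)%N -> jcoord z 2 = 0 -> (orbit_dim gens z <= maxn n 1)%N).
Proof.
rewrite orbit_dimE.
have d1 : dilation_row z = 0 -> inversion_row z = 0 ->
    (\dim <<orbit_rows z>> <= 1)%N.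
  move=> A0 B0; apply: (@dim_span_le _ _ [:: delta_mx 0 0]) => w.
  rewrite /orbit_rows A0 B0 !inE => /or3P[]/eqP->; rewrite ?mem0v //.
  by rewrite memv_span ?mem_head.
have d2 : inversion_row z = 0 -> (\dim <<orbit_rows z>> <= 2)%N.
  move=> B0; apply: (@dim_span_le _ _ [:: delta_mx 0 0; dilation_row z]) => w.
  rewrite /orbit_rows B0 !inE => /or3P[]/eqP->; rewrite ?mem0v //;
  by rewrite memv_span // !inE eqxx ?orbT.
have d3 := dim_span (orbit_rows z).
split.
  case: n z d1 d2 d3 => [|[|n]] z d1 d2 d3 //=.
  - by apply: d1; rewrite ?dilation_row0 ?inversion_row0.
  - by apply: d2; rewrite inversion_row0.
case: n z d1 d2 d3 => [|[|[|n]]] z d1 d2 d3 //= _ /eqP z0.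
- by apply: d1; rewrite ?dilation_row0 ?inversion_row0.
- by apply: d1; rewrite ?dilation_row0 ?inversion_row0 ?z0.
- by apply: d2; rewrite inversion_row0 ?z0.
Qed.

(** The components along x, u_(1) and u_(2) of the three vectors form a
    triangular matrix with diagonal 1, u_(1), u_(1); for n = 0 and n = 1 only
    the first one or two rows are present. *)
Lemma orbit_dim_regular n (z : jet R n) : (n == 0)%N || (jcoord z 2 != 0) ->
  orbit_dim gens z = minn n.+1 3.
Proof.
move=> H; apply/eqP; rewrite eqn_leq (orbit_dim_le z).1 /= orbit_dimE.
have le_dim (X : seq (jet R n)) : {subset X <= orbit_rows z} -> free X ->
    (size X <= \dim <<orbit_rows z>>)%N.
  move=> XY /eqP <-; apply/dimvS/span_subvP => w wX.
  by apply: memv_span; exact: XY.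
have indep p q r : p *: delta_mx 0 0 +
    (q *: dilation_row z + r *: inversion_row z) = 0 ->
  [/\ p = 0, (0 < n)%N -> q = 0 & (1 < n)%N -> r = 0].
  move=> S0; have {}S0 i : (i < n.+2)%N -> p * (i == 0)%:R +
      (q * (i.-1%:R * jcoord z i) + r * ('C(i.-1, 2)%:R * jcoord z i.-1)) = 0.
    move=> il; rewrite -inversion_coord // -dilation_coord //.
    have := congr1 (fun w => jcoord w i) S0.
    by rewrite !jcoordD !jcoordZ delta_coord jcoord0.
  have u0 : (0 < n)%N -> jcoord z 2 != 0 by move=> n0; move: H; rewrite eqn0Ngt n0.
  split.
  - by have := S0 0%N isT; rewrite bin_small //= !mul0r !mulr0 mulr1 !addr0.
  - move=> n0; have := S0 2%N n0.
    rewrite bin_small //= mul0r mulr0 mulr0 add0r addr0 mul1r.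
    by move/eqP; rewrite mulf_eq0 (negPf (u0 n0)) orbF => /eqP.
  - move=> n1; have := S0 3%N n1; have := S0 2%N (ltnW n1).
    rewrite bin_small //= mul0r !mulr0 add0r addr0 mul1r => /eqP.
    have n0 := ltnW n1; rewrite mulf_eq0 (negPf (u0 n0)) orbF => /eqP ->.
    rewrite mul0r !add0r => /eqP.
    by rewrite mulf_eq0 (negPf (u0 n0)) orbF => /eqP.
have fr X : {subset X <= orbit_rows z} -> size X = minn n.+1 3 -> free X ->
   (minn n.+1 3 <= \dim <<orbit_rows z>>)%N by move=> XY <-; exact: le_dim.
case n0 : (n == 0)%N.
  apply: (fr [:: delta_mx 0 0]) => [w||].
  - by rewrite !inE => ->.
  - by rewrite /=; lia.
  apply/freeP => k; rewrite big_ord_recl big_ord0 addr0 /= => k0 i.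
  rewrite (ord1 i); case: (indep (k 0) 0 0) => //.
  by rewrite !scale0r !addr0.
case n1 : (n == 1)%N.
  apply: (fr [:: delta_mx 0 0; dilation_row z]) => [w||].
  - by rewrite !inE => /orP[] ->; rewrite ?orbT.
  - by rewrite /=; lia.
  apply/freeP => k; rewrite !big_ord_recl big_ord0 addr0 /= => k0.
  have [|a b _] := indep (k ord0) (k (lift ord0 ord0)) 0.
    by rewrite scale0r addr0.
  move=> [[|[|//]] il]; [rewrite -[RHS]a | rewrite -[RHS]b; last by lia];
    by congr (k _); exact/val_inj.
have n2 : (1 < n)%N by lia.
apply: (fr (orbit_rows z)) => //=; first by lia.
apply/freeP => k; rewrite !big_ord_recl big_ord0 addr0 /= => /indep[a b c].
move=> [[|[|[|//]]] il]; [rewrite -[RHS]a | rewrite -[RHS](b (ltnW n2))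
   | rewrite -[RHS](c n2)]; by congr (k _); exact/val_inj.
Qed.

Lemma regular_jet n : exists z : jet R n, (n == 0)%N || (jcoord z 2 != 0).
Proof.
exists (\row_(i < n.+2) 1); case: n => [//|n].
by rewrite (jcoord_row (fun=> 1)) // oner_neq0.
Qed.

Lemma s_sl2 n : s_ gens n = minn n.+1 3.
Proof.
apply: nat_max_eq; last by move=> _ [z _ <-]; case: (orbit_dim_le z).
by have [z zr] := regular_jet n; exists z => //; exact: orbit_dim_regular.
Qed.

Lemma regular_V n (z : jet R n) : (n == 0)%N || (jcoord z 2 != 0) -> V_ gens z.
Proof. by move=> zr; rewrite /V_ /= s_sl2 orbit_dim_regular. Qed.

Lemma V_regular n (z : jet R n) : (n <= 2)%N -> V_ gens z ->
  (n == 0)%N || (jcoord z 2 != 0).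
Proof.
move=> n2; rewrite /V_ /= s_sl2 => zV; case: eqVneq => //= n0; apply/eqP => z0.
by have := (orbit_dim_le z).2 n2 z0; rewrite zV; lia.
Qed.
End Orbits.

(** * Invariants normalized by a moving frame *)

Section Invariants.
Context {R : realType}.
Local Notation gens := (sl2_generators R).

(** Coordinate 2 is u_(1).  For n >= 3 there are generic points outside this
    set, with u_(1) = 0 and u_(2) nonzero. *)
Definition regular n : set (jet R n) :=
  [set z | (n == 0)%N || (jcoord z 2 != 0)].

Lemma open_regular n : open (@regular n).
Proof.
rewrite /regular; case: n => [|n] /=.
  by rewrite (_ : [set _ | _] = setT); [exact: openT | apply/seteqP; split].
apply: (@open_comp _ _ (fun z : jet R n.+1 => jcoord z 2) [set x | x != 0]).
  by move=> z _; apply: differentiable_continuous; exact: differentiable_jcoord.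
exact: open_neq.
Qed.

(** With a and b the two functions below, the substitution of
    a X / (1 - b X) for the increment of x turns the first two Taylor
    coefficients u_(1) and u_(2) / 2 into 1 and 0. *)
Definition frame_scale n (z : jet R n) : R := (jcoord z 2)^-1.
Definition frame_shift n (z : jet R n) : R :=
  - (jcoord z 3 / 2) * frame_scale z ^+ 2.

(** The coefficient of X^(m+1) in u (x + a X / (1 - b X)), because that of
    (a X / (1 - b X))^(i+1) is (m choose i) a^(i+1) b^(m-i). *)
Definition normalized n (m : nat) (z : jet R n) : R :=
  \sum_(i < m.+1) 'C(m, i)%:R / (i.+1)`!%:R *
    (jcoord z i.+2 * frame_scale z ^+ i.+1 * frame_shift z ^+ (m - i)).

Section Derivative.
Variables (n m : nat) (z h : jet R n).
Hypothesis z2 : jcoord z 2 != 0.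
Let a := frame_scale z.
Let b := frame_shift z.
Let da : R := - a ^+ 2 * jcoord h 2.
Let db : R := - (jcoord h 3 / 2) * a ^+ 2 + jcoord z 3 * a ^+ 3 * jcoord h 2.

Lemma dfun_frame_scale : is_derive z h (@frame_scale n) da.
Proof.
apply: is_derive_eq (dfun_inv (dfun_jcoord 2 z h) z2) _.
by rewrite /da /a /frame_scale; ring.
Qed.

Lemma dfun_frame_shift : is_derive z h (@frame_shift n) db.
Proof.
eapply is_derive_eq.
  apply: dfun_mul; last exact: dfun_exp dfun_frame_scale.
  by der_rules ltac:(eapply dfun_jcoord).
by rewrite /db /= -/a /da; field.
Qed.

Lemma dfun_normalized : is_derive z h (@normalized n m)
  (\sum_(i < m.+1) 'C(m, i)%:R / (i.+1)`!%:R *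
    (jcoord h i.+2 * a ^+ i.+1 * b ^+ (m - i) +
     jcoord z i.+2 * (i.+1%:R * a ^+ i * da) * b ^+ (m - i) +
     jcoord z i.+2 * a ^+ i.+1 * ((m - i)%:R * b ^+ (m - i).-1 * db))).
Proof.
apply: dfun_sum => i; eapply is_derive_eq.
  by der_rules ltac:(first
    [eapply dfun_jcoord | exact: dfun_frame_shift | exact: dfun_frame_scale]).
by rewrite /= -/a -/b; ring.
Qed.
End Derivative.

Section Invariance.
Variables (n m : nat) (z : jet R n).
Hypotheses (n1 : (1 < n)%N) (mn : (m < n)%N) (z2 : jcoord z 2 != 0).

Lemma normalized_translation : 'D_(delta_mx 0 0) (@normalized n m) z = 0.
Proof.
apply: dfun_val (dfun_normalized m (delta_mx 0 0) z2) _.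
by apply: big1 => i _; rewrite !delta_coord /=; ring.
Qed.

(** When u_(k) is given weight k, the scale a has weight -1 and the shift b
    has weight 0, so every term is homogeneous of weight 0. *)
Lemma normalized_dilation : 'D_(dilation_row z) (@normalized n m) z = 0.
Proof.
apply: dfun_val (dfun_normalized m (dilation_row z) z2) _.
apply: big1 => i _.
have im : (i.+2 < n.+2)%N by have := ltn_ord i; lia.
rewrite !dilation_coord //=; last by lia.
have ez : jcoord z 2 = (frame_scale z)^-1 by rewrite /frame_scale invrK.
have a0 : frame_scale z != 0 by rewrite invr_eq0.
rewrite ez !exprS; field.
by rewrite a0 pnatr_eq0 -lt0n fact_gt0.
Qed.

(** This field acts on the scale a by 0 and on the shift b by - a / 2; after
    reindexing, the derivatives of the u_(k) compensate those of b. *)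
Lemma normalized_inversion : 'D_(inversion_row z) (@normalized n m) z = 0.
Proof.
apply: dfun_val (dfun_normalized m (inversion_row z) z2) _.
have a0 : frame_scale z != 0 by rewrite invr_eq0.
have ez : jcoord z 2 = (frame_scale z)^-1 by rewrite /frame_scale invrK.
(* Each summand is a difference of consecutive values of G, by the
   identity (i+1) (m choose i+1) = (m-i) (m choose i). *)
pose G i : R := - (i%:R / 2 * ('C(m, i)%:R / i`!%:R) * jcoord z i.+1 *
  frame_scale z ^+ i.+1 * frame_shift z ^+ (m - i)).
transitivity (\sum_(0 <= i < m.+1) (G i.+1 - G i)); last first.
  rewrite telescope_sumr // /G bin_small //; ring.
rewrite big_mkord; apply: eq_bigr => -[i /= im] _.
rewrite !inversion_coord //=; try by lia.
rewrite /G [in jcoord z 2]ez.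
have f0 : (i`!)%:R != 0 :> R by rewrite pnatr_eq0 -lt0n fact_gt0.
have -> : (i.+1)`!%:R = i.+1%:R * i`!%:R :> R by rewrite factS natrM.
have i0 : i.+1%:R != 0 :> R by rewrite pnatr_eq0.
have C2 : 'C(i.+1, 2)%:R = i.+1%:R * i%:R / 2 :> R.
  have := mul_bin_diag i.+1 1; rewrite bin1 /= => /(congr1 (fun n => n%:R : R)).
  by rewrite !natrM => ->; field.
have CS : i.+1%:R * 'C(m, i.+1)%:R = (m - i)%:R * 'C(m, i)%:R :> R.
  by rewrite -!natrM mul_bin_left.
rewrite C2 subnS.
have -> : 'C(m, i.+1)%:R = (m - i)%:R * 'C(m, i)%:R / i.+1%:R :> R.
  by rewrite -CS; field.
by rewrite !exprS (@bin_small 1 2) // binn; field; rewrite f0 nat1r i0 a0.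
Qed.
End Invariance.
End Invariants.

(** * The number of independent invariants *)

Section Counting.
Context {R : realType}.
Local Notation gens := (sl2_generators R).

Lemma invariant_of_rows n (f : jet R n -> R) (z : jet R n) v :
  differentiable f z -> {in orbit_rows z, forall w, 'D_w f z = 0} ->
  gens v -> 'D_(prolong v z) f z = 0.
Proof.
move=> df fr vg.
have : [set prolong v z | v in gens] (prolong v z) by exists v.
rewrite prolonged_span /orbit_rows /= !span_cons span_nil addv0.
have fr' w : w \in orbit_rows z -> 'd f z w = 0.
  by move=> wr; rewrite -deriveE ?fr.
move=> /memv_addP[_ /vlineP[p ->] [_ /memv_addP[_ /vlineP[q ->]
  [_ /vlineP[r ->] ->]] ->]].
by rewrite deriveE // !linearD !linearZ /= !fr' ?scaler0 ?addr0 //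
  !inE eqxx ?orbT.
Qed.

Lemma rows_of_invariant n (U : set (jet R n)) (f : jet R n -> R) (z w : jet R n) :
  diff_invariant gens U f -> U z -> w \in <<orbit_rows z>>%VS ->
  'D_w f z = 0.
Proof.
move=> [_ _ fI] Uz wr.
have : [set w | w \in <<orbit_rows z>>%VS] w by [].
by rewrite -prolonged_span => -[v vg <-]; exact: fI.
Qed.

Lemma smooth_differentiable n (U : set 'rV[R]_n) f p :
  smooth_on U f -> U p -> differentiable f p.
Proof. by move=> sf Up; exact: (sf 1%N).1. Qed.

Lemma Ck_on_frame_scale n k : (0 < n)%N ->
  Ck_on k (@regular R n) (@frame_scale R n).
Proof.
move=> n0; apply: Ck_onV; [exact: open_regular | | exact: Ck_on_jcoord].
by move=> p; rewrite /regular /= eqn0Ngt n0.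
Qed.

Lemma smooth_normalized n m : (0 < n)%N ->
  smooth_on (@regular R n) (@normalized R n m).
Proof.
move=> n0 k; apply: Ck_on_sum; first exact: open_regular.
move=> i; rewrite /frame_shift.
by Ck_rules ltac:(first [exact: open_regular | apply: Ck_on_jcoord |
  exact: Ck_on_frame_scale]).
Qed.

Lemma normalized_invariant n m : (1 < n)%N -> (m < n)%N ->
  diff_invariant gens (@regular R n) (normalized m).
Proof.
move=> n1 mn; have n0 := ltnW n1; split; first exact: open_regular.
  exact: smooth_normalized.
move=> v vg z zr; have z2 : jcoord z 2 != 0.
  by move: zr; rewrite /regular /= eqn0Ngt n0.
apply: invariant_of_rows vg.
  exact: smooth_differentiable (smooth_normalized m n0) zr.
move=> w; rewrite !inE => /or3P[]/eqP->.
- exact: normalized_translation.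
- exact: normalized_dilation.
- exact: normalized_inversion.
Qed.

Lemma u_invariant n (U : set (jet R n)) : open U -> diff_invariant gens U (ju 0).
Proof.
move=> oU; have su : smooth_on U (ju 0) by move=> k; exact: Ck_on_jcoord.
split=> // v vg z Uz; apply: invariant_of_rows vg.
  exact: smooth_differentiable su Uz.
move=> w; rewrite !inE => /or3P[]/eqP->; apply: dfun_val (dfun_jcoord 1 z _) _.
- by rewrite delta_coord.
- by rewrite dilation_coord // mul0r.
- by rewrite inversion_coord // mul0r.
Qed.

(** Independent differentials define a surjective linear map onto a space of
    dimension k, whose kernel contains the tangent space of the orbit. *)
Lemma independent_bound n k (z : jet R n) (U : set (jet R n))
    (I : 'I_k -> jet R n -> R) :
  V_ gens z -> U z -> (forall l, diff_invariant gens U (I l)) ->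
  functionally_independent U I -> (k + minn n.+1 3 <= n.+2)%N.
Proof.
move=> zV Uz II ind; have [w] := ind z Uz; rewrite /wedge_d => det0.
have dI l : differentiable (I l) z.
  by have [_ sI _] := II l; exact: smooth_differentiable sI Uz.
pose D : 'M[R]_(n.+2, k) := \matrix_(i, l) 'd (I l) z (delta_mx 0 i).
have DE (x : 'rV[R]_n.+2) l : (x *m D) 0 l = 'd (I l) z x.
  rewrite [in RHS](row_sum_delta x) linear_sum mxE; apply: eq_bigr => i _.
  by rewrite linearZ /= mxE.
pose f := linfun (mulmxr D : 'rV[R]_n.+2 -> 'rV[R]_k).
have fE x : f x = x *m D by rewrite lfunE.
pose W : 'M[R]_(k, n.+2) := \matrix_(j, i) w j 0 i.
have WD : W *m D = (\matrix_(i < k, j < k) 'd (I i) z (w j))^T.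
  apply/matrixP => j l; rewrite !mxE -DE mxE.
  by apply: eq_bigr => i _; rewrite !mxE.
have WDu : W *m D \in unitmx by rewrite WD unitmxE det_tr unitfE.
have surj : (fullv <= f @: fullv)%VS.
  apply/subvP => y _; rewrite -(mulmxKV WDu y) mulmxA -fE.
  exact/memv_img/memvf.
have ker : (<<orbit_rows z>> <= fullv :&: lker f)%VS.
  rewrite capfv; apply/subvP => x xr; rewrite memv_ker fE; apply/eqP/rowP => l.
  by rewrite DE mxE -deriveE //; exact: rows_of_invariant (II l) Uz xr.
have := limg_ker_dim f fullv.
have := dimvS surj; have := dimvS ker; rewrite !dimvf !dim_matrix !mul1r.
move: zV; rewrite /V_ /= s_sl2 orbit_dimE => ->.
by lia.
Qed.

(** The subtraction is truncated: up to order 2 the function u is alone. *)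
Lemma i_sl2 n : i_ gens n = (1 + (n - 2))%N.
Proof.
apply: nat_max_eq; last first.
  move=> k [z [U [I [zV Uz II ind]]]].
  by have := independent_bound zV Uz II ind; lia.
have [z zr] := @regular_jet R n.
pose I (l : 'I_(1 + (n - 2))) : jet R n -> R :=
  if (l == 0 :> nat) then ju 0 else normalized l.+1.
exists z, (@regular R n), I; split.
- exact: regular_V.
- exact: zr.
- move=> l; rewrite /I; case: eqP => l0.
    by apply: u_invariant; exact: open_regular.
  by apply: normalized_invariant; have := ltn_ord l; lia.
move=> p pr; pose idx (j : 'I_(1 + (n - 2))) : 'I_n.+2 :=
  inord (if j == 0 :> nat then 1 else j + 3)%N.
have idxE (j : 'I_(1 + (n - 2))) :
    idx j = (if j == 0 :> nat then 1 else j + 3)%N :> nat.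
  by rewrite inordK //; have := ltn_ord j; case: eqP => /=; lia.
have dI l : differentiable (I l) p.
  rewrite /I; case: eqP => l0; first exact: differentiable_jcoord.
  apply: smooth_differentiable pr; apply: smooth_normalized.
  by have := ltn_ord l; lia.
(* The directions are u, u_(3), ..., u_(n), in the order of the invariants
   of which they are the leading variables. *)
exists (fun j => delta_mx 0 (idx j)); rewrite /wedge_d.
set M := \matrix_(i, j) _.
have p2 (l : 'I_(1 + (n - 2))) : l != 0%N :> nat -> jcoord p 2 != 0.
  move=> l0; have := pr; rewrite /regular /= => /orP[/eqP n0|//].
  by have := ltn_ord l; lia.
have ME (i j : 'I_(1 + (n - 2))) : (i <= j)%N ->
    M i j = if i == j then (if i == 0 :> nat then 1
                            else frame_scale p ^+ i.+2 / (i.+2)`!%:R) else 0.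
  move=> ij; rewrite mxE -deriveE // /I; case: eqP => i0.
    apply: dfun_val (dfun_jcoord 1 p _) _; rewrite delta_coord idxE.
    rewrite -val_eqE /= i0; case: (nat_of_ord j) => [//|j' /=].
    by rewrite (_ : (1 == j'.+1 + 3)%N = false) //; lia.
  apply: dfun_val (dfun_normalized i.+1 _ (p2 i (introN eqP i0))) _.
  have j0 : (j == 0%N :> nat) = false by lia.
  have j2 : (2 == j + 3)%N = false by lia.
  have j3 : (3 == j + 3)%N = false by lia.
  have ej t : jcoord (delta_mx 0 (idx j) : jet R n) t = (t == j + 3)%N%:R.
    by rewrite delta_coord idxE j0.
  rewrite !ej j2 j3 big_ord_recr big1 /= ?add0r => [|t _].
    rewrite ej; have -> : (i.+3 == j + 3)%N = (i == j) by rewrite -val_eqE /=; lia.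
    by rewrite binn subnn; case: (i == j) => /=; rewrite ?mulr1n ?mulr0n; ring.
  rewrite ej; have -> : (t.+2 == j + 3)%N = false by have := ltn_ord t; lia.
  by rewrite mulr0n; ring.
have Mtrig : is_trig_mx M.
  apply/is_trig_mxP => i j ij; rewrite ME ?(ltnW ij) //.
  by case: eqP ij => // ->; rewrite ltnn.
rewrite det_trig //; apply/prodf_neq0 => i _; rewrite ME // eqxx.
case: (nat_of_ord i =P 0%N) => i0; first exact: oner_neq0.
rewrite mulf_neq0 //; first by rewrite expf_neq0 // invr_eq0 (p2 i) //; exact/eqP.
Qed.
End Counting.

(** * Invariants of order at most three *)

Section LowOrder.
Context {R : realType}.
Local Notation gens := (sl2_generators R).

(** Chain rule: a derivation that kills the inner functions kills the
    composite. *)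
Lemma invariant_of_function (G : set (vfield R)) n k (z : jet R n)
    (J : k.-tuple (jet R n -> R)) (I : jet R n -> R) (U : set (jet R n)) :
  open U -> U z -> (forall l, diff_invariant G U (tnth J l)) ->
  function_of_near z J I -> invariant_near G z I.
Proof.
move=> oU Uz JI [W [P [f [oW Wz oP sf fE]]]].
have oWU : open (W `&` U) by exact: openI.
have eqI : {in W `&` U, (fun w => f (\row_l tnth J l w)) =1 I}.
  by move=> w; rewrite inE => -[/fE[_ ->]].
have dJ w l : U w -> differentiable (tnth J l) w.
  by move=> Uw; have [_ sJ _] := JI l; exact: smooth_differentiable sJ Uw.
exists (W `&` U); split=> //; split=> //.
  move=> m; apply: Ck_on_ext eqI _ => //; apply: Ck_on_comp (sf m) _ => //.
    by move=> w [/fE[]].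
  move=> l; have [_ sJ _] := JI l.
  by apply: Ck_onS (sJ m) => w [].
move=> v Gv w WUw; have [Ww Uw] := WUw.
rewrite -(near_eq_derive _ (near_of_open oWU eqI WUw)) chain_row.
- by apply: big1 => l _; have [_ _ ->] := JI l; rewrite ?mul0r.
- by move=> l; exact: dJ.
- by apply: smooth_differentiable sf _; have [] := fE w Ww.
Qed.

(** The argument lists the coordinates x, u, u_(1), u_(2), u_(3). *)
Definition schwarzian (a : nat -> R) : R :=
  (2 * a 2%N * a 4%N - 3 * a 3%N ^+ 2) / (2 * a 2%N ^+ 4).

(** It is 6 times the normalized Taylor coefficient of order 3. *)
Lemma schwarzian_invariant :
  diff_invariant gens (@regular R 3) (fun w => schwarzian (jcoord w)).
Proof.
have [oU sN dN] := @normalized_invariant R 3 2 isT isT.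
have eqK : {in @regular R 3, (fun w => 6 * normalized 2 w) =1
    (fun w => schwarzian (jcoord w))}.
  move=> w; rewrite inE /regular /= => w2.
  rewrite /normalized /schwarzian !big_ord_recr big_ord0 /=.
  rewrite /frame_shift /frame_scale.
  by rewrite /bump /= !expr0 !factS fact0 bin0 bin1 binn subn0 subn1 /=; field.
split=> //.
  move=> k; apply: Ck_on_ext eqK _ => //.
  by apply: Ck_onM; [| exact: Ck_on_cst | exact: sN].
move=> v gv w wU; rewrite -(near_eq_derive _ (near_of_open oU eqK wU)).
have dw : derivable (@normalized R 3 2) w (prolong v w).
  by apply/diff_derivable; exact: smooth_differentiable sN wU.
apply: dfun_val (dfun_mul (dfun_cst 6 w _) (derivableP dw)) _.
by rewrite dN // mulr0 mulr0 addr0.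
Qed.

(** Change of the fifth coordinate from K to u_(3), with the other four
    unchanged, and its inverse. *)
Definition from_schwarzian (a : nat -> R) (i : nat) : R :=
  if i == 4%N then a 2%N ^+ 3 * a 4%N + 3 / 2 * a 3%N ^+ 2 / a 2%N else a i.
Definition to_schwarzian (a : nat -> R) (i : nat) : R :=
  if i == 4%N then schwarzian a else a i.

Definition chart n (a : nat -> R) : jet R n := \row_(i < n.+2) from_schwarzian a i.

(** Missing coordinates are set to 1 and not to 0: then u_(1) is invertible
    for n = 0 too, and the change of coordinates makes sense for every n. *)
Definition padded n (z : jet R n) (i : nat) : R :=
  if (i < n.+2)%N then jcoord z i else 1.
Definition coords n (z : jet R n) := to_schwarzian (padded z).

Lemma eq_chart n a b : (n <= 3)%N -> (forall i, (i < 5)%N -> a i = b i) ->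
  chart n a = chart n b.
Proof.
move=> n3 ab; apply/rowP => i; rewrite !mxE /from_schwarzian !ab //.
by have := ltn_ord i; lia.
Qed.

Lemma from_schwarzianK a i : a 2%N != 0 ->
  from_schwarzian (to_schwarzian a) i = a i.
Proof.
move=> a2; rewrite /from_schwarzian /to_schwarzian /=; case: eqP => // ->.
by rewrite /schwarzian; field.
Qed.

Lemma coordsK n (z : jet R n) : padded z 2%N != 0 -> chart n (coords z) = z.
Proof.
move=> z2; apply: jet_eq => i il.
rewrite (jcoord_row (fun i => from_schwarzian (coords z) i)) //.
by rewrite from_schwarzianK // /padded il.
Qed.

(** The curve fixes u and K, whose differentials cut out the tangent space of
    the orbit, so its tangent lies in that space. *)
Lemma invariant_on_fibre n (U : set (jet R n)) (I : jet R n -> R) (a b : nat -> R) :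
  (n <= 3)%N -> diff_invariant gens U I -> a 1%N = b 1%N -> a 4%N = b 4%N ->
  (forall s : R, s \in `[0, 1] ->
     a 2%N + s * (b 2%N - a 2%N) != 0 /\
     U (chart n (fun i => a i + s * (b i - a i)))) ->
  I (chart n a) = I (chart n b).
Proof.
move=> n3 UI ab1 ab4 abU.
pose c (i : nat) (s : R) := from_schwarzian (fun i => a i + s * (b i - a i)) i.
pose d i := b i - a i.
pose dc (i : nat) (s : R) := let p := fun i => a i + s * d i in
  if i == 4%N then 3 * p 2%N ^+ 2 * d 2%N * a 4%N +
    (3 * p 3%N * d 3%N / p 2%N - 3 / 2 * p 3%N ^+ 2 * d 2%N / p 2%N ^+ 2) else d i.
have := @constant_along_curve R n.+2 U I (fun j => c j) (fun j => dc j).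
rewrite (_ : \row_j c j 0 = chart n a); last first.
  apply/rowP => j; rewrite !mxE; rewrite /c.
  rewrite (_ : (fun i => _) = a) //.
  by apply/funext => i; rewrite mul0r addr0.
rewrite (_ : \row_j c j 1 = chart n b); last first.
  apply/rowP => j; rewrite !mxE; rewrite /c.
  rewrite (_ : (fun i => _) = b) //.
  by apply/funext => i; rewrite mul1r addrC subrK.
apply.
- by move=> p; have [_ sI _] := UI; exact: smooth_differentiable sI.
- by move=> s /abU[].
- move=> s /abU[p0 _] j; rewrite /c /dc /from_schwarzian.
  have lin i : is_derive s 1 (fun s => a i + s * (b i - a i)) (d i).
    eapply is_derive_eq; first by der_rules ltac:(eapply is_derive_id).
    by rewrite /= /d; ring.
  case: eqP => _; last exact: lin.
  eapply is_derive_eq.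
    by der_rules ltac:(first
      [eapply lin | eapply dfun_inv; [eapply lin | exact: p0]]).
  rewrite /= /d ab4 subrr; move: p0.
  move: (a 2%N + s * _) (a 3%N + s * _) => p2 p3 p0.
  by field; exact: p0.
move=> s s01; have [p0 Us] := abU s s01.
apply: rows_of_invariant UI Us _.
set y := chart n _.
pose p i := a i + s * d i.
(* The components along x, u_(1), u_(2) determine the three coefficients;
   the component along u_(3) then agrees because K is constant. *)
have -> : \row_j dc j s = d 0%N *: delta_mx 0 0 +
  ((d 2%N / p 2%N) *: dilation_row y +
   ((d 3%N - 2 * p 3%N * d 2%N / p 2%N) / p 2%N) *: inversion_row y).
  have yE i : (i < n.+2)%N -> jcoord y i = from_schwarzian p i.
    by move=> il; rewrite [LHS](jcoord_row (fun i => from_schwarzian p i)).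
  apply/rowP => -[i il].
  rewrite !mxE /= yE // yE; last by lia.
  have i5 : (i < 5)%N by lia.
  have [C02 C12 C22 C32] : [/\ 'C(0, 2) = 0, 'C(1, 2) = 0, 'C(2, 2) = 1 &
    'C(3, 2) = 3]%N by [].
  case: i il i5 => [|[|[|[|[|//]]]]] il _; rewrite /dc /from_schwarzian /=.
  - by rewrite C02; ring.
  - by rewrite C02 /d ab1; ring.
  - by rewrite C12; field; exact: p0.
  - by rewrite C22; field; exact: p0.
  rewrite C32 (_ : p 4%N = a 4%N) -/(p 2%N) -/(p 3%N).
    by field; exact: p0.
  by rewrite /p /d ab4; ring.
by rewrite !memvD // memvZ // memv_span // !inE eqxx ?orbT.
Qed.

(** Neighbourhoods for the product topology contain boxes, and each edge of
    the box is controlled separately. *)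
Lemma continuous_box n (f : nat -> jet R n -> R) k (P : set 'rV[R]_k) z :
  (forall i, {for z, continuous (f i)}) ->
  nbhs (\row_(i < k) f i z) P ->
  \forall w \near z, forall b : nat -> R,
    (forall i, `|b i - f i z| <= `|f i w - f i z|) -> P (\row_(i < k) b i).
Proof.
move=> cf [B nB BP].
pose good (i : 'I_k) (w : jet R n) := exists2 e : R,
   `|f i w - f i z| < e & forall t : R, `|t - f i z| < e -> B 0 i t.
have nF : \forall w \near z, forall i, good i w.
  apply: (@filter_forall _ _ good (nbhs z)) => i.
  have := nB 0 i; rewrite mxE => /nbhs_ballP[e /= e0 eB].
  have nb : nbhs (f i z) (ball (f i z) e) by exact: nbhsx_ballx.
  have nw : nbhs z (f i @^-1` ball (f i z) e) := cf i _ nb.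
  apply: filterS nw => w wB; exists e.
    by move: wB; rewrite /ball /= distrC.
  by move=> t te; apply: eB; rewrite /ball /= distrC.
near=> w => b bw; apply: BP => i j; rewrite mxE (ord1 i).
have [e we eB] : exists2 e : R, `|f j w - f j z| < e &
    forall t : R, `|t - f j z| < e -> B 0 j t.
  by move: (j); near: w.
by apply: eB; apply: le_lt_trans (bw j) we.
Unshelve. all: by end_near. Qed.

Lemma Ck_on_padded n i k (U : set (jet R n)) :
  Ck_on k U (fun w : jet R n => padded w i).
Proof.
rewrite /padded; case: (i < n.+2)%N; [exact: Ck_on_jcoord | exact: Ck_on_cst].
Qed.

Lemma padded_regular n (z : jet R n) : regular z -> padded z 2 != 0.
Proof.
rewrite /regular /= /padded; case: n z => [|n] z //= _; exact: oner_neq0.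
Qed.

Lemma Ck_on_coords n i k : Ck_on k (@regular R n) (fun w : jet R n => coords w i).
Proof.
rewrite /coords /to_schwarzian /schwarzian; case: (i == 4%N);
  last exact: Ck_on_padded.
apply: Ck_onM; [exact: open_regular | |].
  by Ck_rules ltac:(first [exact: open_regular | apply: Ck_on_padded]).
apply: Ck_onV; [exact: open_regular | |].
  by move=> w /padded_regular w0; rewrite mulf_neq0 ?expf_neq0.
by Ck_rules ltac:(first [exact: open_regular | apply: Ck_on_padded]).
Qed.

Lemma Ck_on_from_schwarzian m (U : set 'rV[R]_m) (a : nat -> 'rV[R]_m -> R) i k :
  open U -> (forall p, U p -> a 2 p != 0) -> (forall j, Ck_on k U (a j)) ->
  Ck_on k U (fun p => from_schwarzian (a ^~ p) i).
Proof.
move=> oU a0 Ca; rewrite /from_schwarzian; case: (i == 4%N); last exact: Ca.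
apply: Ck_onD => //; first by Ck_rules ltac:(first [exact: oU | exact: Ca]).
apply: Ck_onM => //; first by Ck_rules ltac:(first [exact: oU | exact: Ca]).
exact: Ck_onV.
Qed.

(** Along the curve of [invariant_on_fibre] that joins the slice to w, every
    parameter stays at least as close to its value at z as it is at w; so for w
    near z the curve remains in the domain of I. *)
Lemma invariant_reduction n (z : jet R n) (I : jet R n -> R) :
  (n <= 3)%N -> regular z -> invariant_near gens z I ->
  let slice (t k : R) := chart n
    (fun i => if i == 1%N then t else if i == 4%N then k else coords z i) in
  exists (W U : set (jet R n)), [/\ open W, W z, open U, smooth_on U I &
    forall w, W w -> let p := slice (coords w 1%N) (coords w 4) in
      U p /\ I w = I p].
Proof.
move=> n3 zr [U [Uz UI]] slice; have [oU sI _] := UI.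
have z2 := padded_regular zr.
pose Q : set (jet R 3) := regular (n := 3).
pose P := Q `&` [set a | U (chart n (jcoord a))].
pose a0 : jet R 3 := \row_(i < 5) coords z i.
have a0E i : (i < 5)%N -> jcoord a0 i = coords z i by exact: jcoord_row.
have a0z : chart n (jcoord a0) = z.
  by rewrite -[RHS](coordsK z2); exact: eq_chart.
have Qa0 : Q a0 by rewrite /Q /regular /= a0E.
have P0 : nbhs a0 P.
  apply: filterI; first by apply: open_nbhs_nbhs; split; first exact: open_regular.
  have cQ (j : 'I_n.+2) :
      {for a0, continuous (fun a : jet R 3 => from_schwarzian (jcoord a) j)}.
    apply: (@Ck_on_from_schwarzian _ Q (fun i a => jcoord a i) j 0) => //.
      exact: open_regular.
    by move=> i; exact: Ck_on_jcoord.
  have nU : nbhs (\row_j from_schwarzian (jcoord a0) (j : 'I_n.+2)) U.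
    have : chart n (jcoord a0) =
      \row_j from_schwarzian (jcoord a0) (j : 'I_n.+2) by [].
    by rewrite a0z => <-; exact: open_nbhs_nbhs.
  exact: (cvg_row (F := nbhs a0) cQ nU).
have cc i : {for z, continuous (fun w : jet R n => coords w i)}.
  exact: (@Ck_on_coords n i 0 z zr).
pose W0 := [set w : jet R n | forall b : nat -> R,
  (forall i, `|b i - coords z i| <= `|coords w i - coords z i|) ->
  P (\row_(i < 5) b i)].
have nW : nbhs z W0.
  exact: (@continuous_box n (fun i w => coords w i) _ _ z cc P0).
exists (W0 `&` @regular R n)°, U; split => //.
- exact: open_interior.
- by apply: filterI => //; apply: open_nbhs_nbhs; split; first exact: open_regular.
move=> w /interior_subset[Ww wr].
set p := slice _ _; pose a i := if i == 1%N then coords w 1%N else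
  if i == 4%N then coords w 4%N else coords z i.
have pE : p = chart n a by [].
have path (s : R) : s \in `[0, 1] ->
    a 2%N + s * (coords w 2%N - a 2%N) != 0 /\
    U (chart n (fun i => a i + s * (coords w i - a i))).
  rewrite in_itv /= => /andP[s0 s1]; pose b i := a i + s * (coords w i - a i).
  have [|r2 Ub] := Ww b.
    move=> i; rewrite /b /a; case: eqP => [->|_].
      by rewrite subrr mulr0 addr0.
    case: eqP => [->|_]; first by rewrite subrr mulr0 addr0.
    by rewrite addrAC subrr add0r normrM ger0_norm // ler_piMl.
  have bE i : (i < 5)%N -> jcoord (\row_(i < 5) b i : jet R 3) i = b i.
    by move=> i5; rewrite (@jcoord_row R 3 b).
  split; first by have := r2; rewrite /Q /regular /= bE.
  by have := Ub; rewrite /= (eq_chart n3 bE).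
have w2 := padded_regular wr.
split.
  have i0 : (0 : R) \in `[0, 1] by rewrite in_itv /= lexx ler01.
  have [_] := path 0 i0; rewrite pE (_ : (fun i => _) = a) //.
  by apply/funext => i; rewrite mul0r addr0.
rewrite pE -[in LHS](coordsK w2); apply/esym.
by apply: invariant_on_fibre UI _ _ path.
Qed.
End LowOrder.

Section LowOrder2.
Context {R : realType}.
Local Notation gens := (sl2_generators R).

(** The index i0 locates u among the functions J, and kappa recovers K from
    their values; kappa is arbitrary when n < 3, because then the slice does not
    depend on K. *)
Lemma function_of_invariants n k (z : jet R n) (J : k.-tuple (jet R n -> R))
    (i0 : 'I_k) (kappa : 'rV[R]_k -> R) (I : jet R n -> R) :
  (n <= 3)%N -> regular z -> (forall m U, Ck_on m U kappa) ->
  tnth J i0 = ju 0 ->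
  (n = 3 -> forall w,
     kappa (\row_l tnth J l w) = schwarzian (jcoord w)) ->
  invariant_near gens z I -> function_of_near z J I.
Proof.
move=> n3 zr Ck Ju JK /(invariant_reduction n3 zr)[W [U [oW Wz oU sI WU]]].
have z2 := padded_regular zr.
pose param (i : nat) (y : 'rV[R]_k) : R :=
  if i == 1%N then y 0 i0 else if i == 4%N then kappa y else coords z i.
pose slice (y : 'rV[R]_k) := chart n (param ^~ y).
have Cparam i m V : Ck_on m V (param i).
  rewrite /param; case: (i == 1)%N; first exact: Ck_on_coord.
  by case: (i == 4)%N; [exact: Ck | exact: Ck_on_cst].
have Cslice i m V : open V -> Ck_on m V (fun y => from_schwarzian (param ^~ y) i).
  by move=> oV; apply: Ck_on_from_schwarzian.
pose P := slice @^-1` U.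
have oP : open P.
  apply: open_comp oU => y _.
  have cy (j : 'I_n.+2) :
      {for y, continuous (fun y => from_schwarzian (param ^~ y) j)}.
    exact: (Cslice j 0 setT openT).
  exact: (cvg_row (F := nbhs y) cy).
exists W, P, (fun y => I (slice y)); split => //.
  move=> m; apply: Ck_on_comp (sI m) _ => //.
  by move=> j; exact: Cslice.
move=> w Ww Jw; have [] := WU w Ww; set p := chart n _.
suff -> : p = slice Jw by [].
apply/rowP => i; rewrite !mxE /from_schwarzian.
have pE j : (j < n.+2)%N ->
    (if j == 1%N then coords w 1%N
     else if j == 4%N then coords w 4%N else coords z j) =
    param j Jw.
  rewrite /param => jn; case: eqP => [_|_]; first by rewrite mxE Ju.
  case: eqP => [j4|//]; have n3' : n = 3%N by lia.
  rewrite JK //; rewrite /coords /to_schwarzian /= /schwarzian /padded.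
  have [l2 l3 l4] : [/\ 2 < n.+2, 3 < n.+2 & 4 < n.+2]%N by split; lia.
  by rewrite l2 l3 l4.
have il := ltn_ord i; have := pE i il.
case: (nat_of_ord i =P 4%N) => [i4 _|_ -> //].
have := pE 4%N; by rewrite -{1}i4 => /(_ il) ->.
Qed.

Lemma invariants_upto_2 n (z : jet R n) (I : jet R n -> R) :
  (n <= 2)%N -> V_ gens z ->
  invariant_near gens z I <-> function_of_near z [tuple ju 0] I.
Proof.
move=> n2 zV; have zr : regular z := V_regular n2 zV.
split; last first.
  apply: (@invariant_of_function _ _ _ _ _ _ _ setT openT) => // l.
  by rewrite (ord1 l); apply: u_invariant; exact: openT.
apply: (@function_of_invariants _ _ _ _ ord0 (fun=> 0)) => //.
- exact: leq_trans n2 _.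
- by move=> m U; exact: Ck_on_cst.
- by move=> n3; move: n2; rewrite n3.
Qed.

Lemma invariants_of_order_3 (z : jet R 3) (I : jet R 3 -> R) : ju 1 z != 0 ->
  invariant_near gens z I <->
  function_of_near z [tuple ju 0; (fun w => schwarzian (jcoord w))] I.
Proof.
move=> z2; have zr : regular z by [].
split; last first.
  apply: (@invariant_of_function _ _ _ _ _ _ _ (@regular R 3)) => //.
    exact: open_regular.
  move=> l; case: (ord2 l) => ->; first by apply: u_invariant; exact: open_regular.
  exact: schwarzian_invariant.
apply: (@function_of_invariants _ _ _ _ 0 (fun y => y 0 1)) => //.
- by move=> m U; exact: Ck_on_coord.
- by move=> _ w; rewrite mxE.
Qed.
End LowOrder2.

Theorem mainTheorem1 (R : realType) :
  (sl2_generators R =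
     [set v | exists a b c : R,
        v = dx_field (fun x => a + b * x + c * x ^+ 2)]) /\
  ((forall n : nat, (n <= 2)%N ->
      forall z : jet R n, V_ (sl2_generators R) z ->
      forall I : jet R n -> R,
        invariant_near (sl2_generators R) z I <->
        function_of_near z [tuple ju 0] I) /\
   (forall z : jet R 3, V_ (sl2_generators R) z -> ju 1 z != 0 ->
      forall I : jet R 3 -> R,
        invariant_near (sl2_generators R) z I <->
        function_of_near z
          [tuple ju 0;
             (fun w => (2 * ju 1 w * ju 3 w - 3 * ju 2 w ^+ 2)
                       / (2 * ju 1 w ^+ 4))] I)) /\
  ([/\ i_ (sl2_generators R) 0 = 1%N,
       i_ (sl2_generators R) 1 = 1%N,
       i_ (sl2_generators R) 2 = 1%N &
       forall n : nat, (3 <= n)%N -> i_ (sl2_generators R) n = (n - 1)%N]) /\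
  ([/\ s_ (sl2_generators R) 0 = 1%N,
       s_ (sl2_generators R) 1 = 2%N &
       forall n : nat, (2 <= n)%N -> s_ (sl2_generators R) n = 3%N]) /\
  ([/\ j_ (sl2_generators R) 0 = 1 :> int,
       j_ (sl2_generators R) 1 = 0 :> int,
       j_ (sl2_generators R) 2 = 0 :> int &
       forall n : nat, (3 <= n)%N -> j_ (sl2_generators R) n = 1 :> int]) /\
  ([/\ h_ (sl2_generators R) (dim_SL2 R) 0 = 2 :> int,
       h_ (sl2_generators R) (dim_SL2 R) 1 = 1 :> int &
       forall n : nat, (2 <= n)%N ->
         h_ (sl2_generators R) (dim_SL2 R) n = 0 :> int]).
Proof.
split; first exact: sl2_generatorsE.
split; [split|split; [|split; [|split]]].
- by move=> n n2 z zV I; exact: invariants_upto_2.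
- by move=> z _ z2 I; exact: invariants_of_order_3.
- by split=> [|||n n3]; rewrite i_sl2 //; lia.
- by split=> [||n n2]; rewrite s_sl2 //; lia.
- split=> [|||n n3]; rewrite /j_ ?i_sl2 //.
  by case: n n3 => // n n3; rewrite !i_sl2; lia.
- by split=> [||n n2]; rewrite /h_ dim_SL2E s_sl2 //; lia.
Qed.
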